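(* Let $R$ be a ring, ${}'\mathcal{C}={}'\mathcal{C}_R$ and $\mathfrak{a}=\mathrm{ass}_R({}'\mathcal{C})$. The following statements are equivalent. 1. ${}'Q_{l,\mathrm{cl}}(R)$ is a semisimple Artinian ring. 2. (a) $\mathfrak{a}$ is a semiprime ideal of $R$ and the set $\mathrm{Min}_R(\mathfrak{a})$ is finite. (b) For each $\mathfrak{p}\in\mathrm{Min}_R(\mathfrak{a})$, the ring $R/\mathfrak{p}$ is a left Goldie ring. (c) The set $\overline{{}'\mathcal{C}}:=\{c+\mathfrak{a}\mid c\in{}'\mathcal{C}\}$ is a dense subset of $\mathcal{C}_{\overline{R}}$, where $\overline{R}:=R/\mathfrak{a}$.
   Context: Rings are associative with $1$. For a nonempty subset $S$ of a ring $R$, $\mathrm{ass}_R(S):=\{r\in R\mid sr=0\text{ for some }s\in S\}$. ${}'\mathcal{C}_R$ is the set of left regular elements of $R$: those $r\in R$ such that $xr=0$ ($x\in R$) implies $x=0$. $\mathcal{C}_R$ is the set of regular elements: those $r$ such that $xr=0$ implies $x=0$ and $rx=0$ implies $x=0$. $\mathrm{Min}_R(I)$ is the set of minimal prime ideals over an ideal $I$. A ring is left Goldie if it satisfies the a.c.c. on left annihilators and has finite left uniform dimension. A multiplicative set is a subset $S$ with $1\in S$, $SS\subseteq S$, $0\notin S$. It is a left Ore set if $Sr\cap Rs\neq\emptyset$ for all $r\in R$, $s\in S$. It is a left denominator set if it is left Ore and $rs=0$ with $r\in R$, $s\in S$ implies $r\in\mathrm{ass}_R(S)$; then the left localization $S^{-1}R$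 exists. For multiplicative sets $S\subseteq T$ of $R$, $S$ is dense in $T$ if for each $t\in T$ there is $r\in R$ with $rt\in S$. ${}'Q_{l,\mathrm{cl}}(R):={}'\mathcal{C}_R^{-1}R$; it exists exactly when ${}'\mathcal{C}_R$ is a left denominator set, and the assertion that it is semisimple Artinian includes the assertion that it exists. *)

(* Defs.v *)
From HB Require Import structures.
From mathcomp Require Import all_boot all_algebra.
From mathcomp Require Import generic_quotient.
From mathcomp Require Import boolp classical_sets cardinality.

Set Implicit Arguments.
Unset Strict Implicit.
Unset Printing Implicit Defensive.

Import GRing.Theory.
Local Open Scope classical_set_scope.
Local Open Scope ring_scope.

(* Rings are associative, unital and not necessarily commutative; the zero
   ring is allowed. *)

Section RegularElements.
Variable R : pzRingType.
Implicit Types S T : set R.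

Definition ass S : set R := [set r | exists2 s, S s & s * r = 0].

Definition left_regular : set R := [set r | forall x, x * r = 0 -> x = 0].

Definition regular : set R :=
  [set r | (forall x, x * r = 0 -> x = 0) /\ (forall x, r * x = 0 -> x = 0)].

Definition multiplicative S : Prop :=
  [/\ S 1, forall s t, S s -> S t -> S (s * t) & ~ S 0].

Definition left_ore S : Prop :=
  multiplicative S /\
  forall r s, S s -> exists s' r', S s' /\ s' * r = r' * s.

Definition left_denominator S : Prop :=
  left_ore S /\ forall r s, S s -> r * s = 0 -> ass S r.

Definition dense_in S T : Prop :=
  [/\ multiplicative S, multiplicative T, S `<=` T &
      forall t, T t -> exists r, S (r * t)].

End RegularElements.

Arguments left_regular : clear implicits.
Arguments regular : clear implicits.

Definition invertible (R : pzRingType) (x : R) : Prop :=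
  exists y, y * x = 1 /\ x * y = 1.

(* [f : R -> Q] is the left localization of R at the left denominator set S,
   which is unique up to isomorphism over R. Since [f s] is invertible,
   [f s * q = f r] says that q is the left fraction s^-1 r. *)
Definition is_left_localization (R Q : pzRingType) (S : set R)
    (f : {rmorphism R -> Q}) : Prop :=
  [/\ left_denominator S,
      forall s, S s -> invertible (f s),
      forall q, exists s r, S s /\ f s * q = f r &
      forall r, f r = 0 <-> ass S r].

Section LeftIdeals.
Variable R : pzRingType.
Implicit Types L X : set R.

Definition left_ideal L : Prop :=
  [/\ L 0, forall x y, L x -> L y -> L (x + y) & forall a x, L x -> L (a * x)].

Definition minimal_left_ideal L : Prop :=
  [/\ left_ideal L, L <> [set 0] &
      forall L', left_ideal L' -> L' `<=` L -> L' = [set 0] \/ L' = L].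

Definition left_artinian : Prop :=
  forall L : nat -> set R, (forall n, left_ideal (L n)) ->
    (forall n, L n.+1 `<=` L n) ->
    exists n, forall m, (n <= m)%N -> L m = L n.

(* The left regular module is the sum of its simple submodules. *)
Definition semisimple : Prop :=
  forall x : R, exists (n : nat) (L : 'I_n -> set R) (y : 'I_n -> R),
    (forall i, minimal_left_ideal (L i) /\ L i (y i)) /\ x = \sum_(i < n) y i.

Definition semisimple_artinian : Prop := left_artinian /\ semisimple.

Definition left_ann X : set R := [set r | forall x, X x -> r * x = 0].

Definition acc_left_annihilators : Prop :=
  forall L : nat -> set R, (forall n, exists X, L n = left_ann X) ->
    (forall n, L n `<=` L n.+1) ->
    exists n, forall m, (n <= m)%N -> L m = L n.

Definition independent (L : nat -> set R) : Prop :=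
  forall (n : nat) (x : 'I_n -> R), (forall i : 'I_n, L i (x i)) ->
    \sum_(i < n) x i = 0 -> forall i, x i = 0.

(* There is no infinite direct sum of nonzero left ideals. *)
Definition finite_left_udim : Prop :=
  ~ exists L : nat -> set R,
      (forall n, left_ideal (L n) /\ L n <> [set 0]) /\ independent L.

Definition left_goldie : Prop := acc_left_annihilators /\ finite_left_udim.

End LeftIdeals.

Arguments left_artinian : clear implicits.
Arguments semisimple : clear implicits.
Arguments semisimple_artinian : clear implicits.
Arguments acc_left_annihilators : clear implicits.
Arguments finite_left_udim : clear implicits.
Arguments left_goldie : clear implicits.

(* Two-sided ideals; R itself is an ideal. *)
Record ideal (R : pzRingType) := Ideal {
  ideal_set :> set R;
  ideal_left : left_ideal ideal_set;
  ideal_right : forall x a, ideal_set x -> ideal_set (x * a)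
}.

Section Ideals.
Variable R : pzRingType.
Implicit Types I J A B P : ideal R.

Definition prime_ideal P : Prop :=
  ~ ideal_set P 1 /\
  forall A B,
    (forall a b, ideal_set A a -> ideal_set B b -> ideal_set P (a * b)) ->
    A `<=` P \/ B `<=` P.

Definition semiprime_ideal I : Prop :=
  forall A,
    (forall a b, ideal_set A a -> ideal_set A b -> ideal_set I (a * b)) ->
    A `<=` I.

Definition minimal_primes I : set (ideal R) :=
  [set P | [/\ prime_ideal P, I `<=` P &
    forall P', prime_ideal P' -> I `<=` P' -> P' `<=` P -> P `<=` P']].

End Ideals.

(* The factor ring. The library has the additive quotient [Quotient.quot] by an
   additive subgroup, but its ring structure only in the commutative case. *)

Definition ideal_pred (R : pzRingType) (I : ideal R) : R -> bool :=
  fun x => `[< ideal_set I x >].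

Section IdealPred.
Variables (R : pzRingType) (I : ideal R).

Lemma ideal_predE x : (x \in ideal_pred I) = `[< ideal_set I x >].
Proof. by []. Qed.

Fact ideal_pred_zmod_closed : zmod_closed (ideal_pred I).
Proof.
have [I0 ID IM] := ideal_left I.
split; first exact/asboolP.
move=> x y; rewrite !ideal_predE => /asboolP Ix /asboolP Iy; apply/asboolP.
by apply: ID => //; rewrite -mulN1r; apply: IM.
Qed.

HB.instance Definition _ :=
  GRing.isZmodClosed.Build R (ideal_pred I) ideal_pred_zmod_closed.

Definition ideal_zmod : zmodClosed R :=
  GRing.ZmodClosed.clone R (ideal_pred I) _.

Definition factor_ring : Type := Quotient.quot ideal_zmod.

HB.instance Definition _ := GRing.Zmodule.on factor_ring.

Definition factor_pi (x : R) : factor_ring :=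
  (\pi_(Quotient.quot ideal_zmod) x)%qT.

Lemma factor_pi_surj (q : factor_ring) : exists x, factor_pi x = q.
Proof. by exists (repr q); exact: reprK. Qed.

Lemma factor_pi_eq x y : factor_pi x = factor_pi y <-> ideal_set I (x - y).
Proof.
split=> [/eqP|Ixy].
  by rewrite -Quotient.idealrBE ideal_predE => /asboolP.
by apply/eqP; rewrite -Quotient.idealrBE ideal_predE; apply/asboolP.
Qed.

Definition factor_mul (p q : factor_ring) : factor_ring :=
  factor_pi (repr p * repr q).

Lemma factor_piM : {morph factor_pi : x y / x * y >-> factor_mul x y}.
Proof.
move=> x y; have [I0 ID IM] := ideal_left I.
have Ir z : ideal_set I (z - repr (factor_pi z)) by apply/factor_pi_eq; rewrite [RHS]reprK.
apply/factor_pi_eq; set x' := repr _; set y' := repr _.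
have -> : x * y - x' * y' = x * (y - y') + (x - x') * y'.
  by rewrite mulrBr mulrBl addrA subrK.
by apply: ID; [apply: IM | apply: ideal_right].
Qed.

Lemma factor_piB : {morph factor_pi : x y / x - y >-> x - y}.
Proof. by move=> x y; apply: raddfB. Qed.

Lemma factor_piD : {morph factor_pi : x y / x + y >-> x + y}.
Proof. by move=> x y; apply: raddfD. Qed.

Fact factor_mulA : associative factor_mul.
Proof.
move=> p q r; case: (factor_pi_surj p) (factor_pi_surj q) (factor_pi_surj r).
by move=> x <- [y <-] [z <-]; rewrite -!factor_piM mulrA.
Qed.

Fact factor_mul1l : left_id (factor_pi 1) factor_mul.
Proof. by move=> p; have [x <-] := factor_pi_surj p; rewrite -factor_piM mul1r. Qed.

Fact factor_mul1r : right_id (factor_pi 1) factor_mul.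
Proof. by move=> p; have [x <-] := factor_pi_surj p; rewrite -factor_piM mulr1. Qed.

Fact factor_mulDl : left_distributive factor_mul +%R.
Proof.
move=> p q r; case: (factor_pi_surj p) (factor_pi_surj q) (factor_pi_surj r).
by move=> x <- [y <-] [z <-]; rewrite -!(factor_piM, factor_piD) mulrDl.
Qed.

Fact factor_mulDr : right_distributive factor_mul +%R.
Proof.
move=> p q r; case: (factor_pi_surj p) (factor_pi_surj q) (factor_pi_surj r).
by move=> x <- [y <-] [z <-]; rewrite -!(factor_piM, factor_piD) mulrDr.
Qed.

HB.instance Definition _ := GRing.Zmodule_isPzRing.Build factor_ring
  factor_mulA factor_mul1l factor_mul1r factor_mulDl factor_mulDr.

HB.instance Definition _ :=
  GRing.isZmodMorphism.Build R factor_ring factor_pi factor_piB.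

Fact factor_pi_monoid_morphism : monoid_morphism factor_pi.
Proof. by split; last exact: factor_piM. Qed.

HB.instance Definition _ :=
  GRing.isMonoidMorphism.Build R factor_ring factor_pi factor_pi_monoid_morphism.

Lemma factor_pi_eq0 x : factor_pi x = 0 <-> ideal_set I x.
Proof. by rewrite -(raddf0 factor_pi) factor_pi_eq subr0. Qed.

End IdealPred.

(* Main.v *)
Require Import Defs.
From HB Require Import structures.
From mathcomp Require Import all_boot all_algebra.
From mathcomp Require Import boolp classical_sets cardinality.

(** Write C for the set of left regular elements of R and T for the factor ring
of R by the ideal a = ass C.

Everything about a semisimple Artinian ring Q is drawn from one property, which
is equivalent to it ([semisimple_split], [split_semisimple_artinian]): each left
ideal L contains an element e with u = u e for all u in L. It yields the a.c.c.
on left ideals at once, since the e of the union of an ascending chain already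
lies in a member of the chain.

Let f from R to Q be the localization of R at C, with Q semisimple Artinian.
A two-sided ideal A of R generates a two-sided ideal of Q
([extension_right]): if u c lies in the extension E of A, then u lies in E,
because the left ideals of all v with v c^n in E ascend and hence stabilize. So
primes of Q contract to primes of R; by Noetherian induction some finite list of
primes of Q is such that each prime of R over a = ker f contains the contraction
of one of them. The minimal primes over a are therefore among these finitely
many contractions, and their factor rings inherit the Goldie conditions from the
a.c.c. in Q. A nilpotent ideal of T would extend to an ideal Qe with e = e e = 0.
If c is regular in T, then its image in Q is left regular, hence left invertible
because Q is Artinian; writing the left inverse as s^-1 r gives r c = s modulo a
with s in C, which is the density.

Conversely, a semiprime ideal is the intersection of the minimal primes over it
([semiprime_minimal_prime]), and both Goldie conditions pass from finitely many
prime factors R/p to R/a ([semiprime_factor_goldie]). So T is a semiprime left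
Goldie ring, and Goldie's theorem applies: essential left ideals contain regular
elements ([essential_left_regular]), which gives the Ore condition
([goldie_ore]). By density the image of C in T is a left Ore set of regular
elements that meets each essential left ideal. The ring of fractions is
constructed from graphs of partial homomorphisms, and its left ideals split
because left ideals of T have complements up to essential extension
([goldie_fraction_split]). Finally the left regularity of the elements of C
lifts the Ore condition from T to R. *)

Set Implicit Arguments.
Unset Strict Implicit.
Unset Printing Implicit Defensive.

Import GRing.Theory.
Local Open Scope classical_set_scope.
Local Open Scope ring_scope.

Lemma dependent_choice (X : Type) (P : X -> Prop) (E : X -> X -> Prop) x0 :
  P x0 -> (forall x, P x -> exists y, P y /\ E x y) ->
  exists u : nat -> X,
    [/\ u 0%N = x0, forall n, P (u n) & forall n, E (u n) (u n.+1)].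
Proof.
move=> Px0 step.
have [|g gE] := @choice {x | P x} {x | P x} (fun x y => E (sval x) (sval y)).
  by move=> [x Px]; have [y [Py Exy]] := step x Px; exists (exist _ y Py).
pose u n := iter n g (exist _ x0 Px0).
by exists (fun n => sval (u n)); split=> // n; exact: svalP.
Qed.

(** * Left ideals and finite uniform dimension *)
Section LeftIdealTheory.
Variable R : pzRingType.
Implicit Types (I V W X : set R) (r x y : R).

Lemma left_idealB V x y : left_ideal V -> V x -> V y -> V (x - y).
Proof.
by move=> [_ VD VM] Vx Vy; apply: VD => //; rewrite -mulN1r; apply: VM.
Qed.

Lemma left_ideal_sum V n (F : 'I_n -> R) :
  left_ideal V -> (forall i, V (F i)) -> V (\sum_(i < n) F i).
Proof. by move=> [V0 VD _] VF; elim/big_ind: _. Qed.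

Lemma left_ideal_eq0 V : left_ideal V -> V `<=` [set 0] -> V = [set 0].
Proof. by move=> [V0 _ _] V00; apply/seteqP; split=> // _ ->. Qed.

Definition multiples x : set R := [set r * x | r in setT].

Definition sum_set V W : set R := [set z | exists v w, [/\ V v, W w & z = v + w]].

Lemma left_ideal0 : left_ideal [set 0 : R].
Proof. by split=> // [_ _ -> ->|a _ ->]; rewrite /= ?addr0 ?mulr0. Qed.

Lemma left_idealT : left_ideal [set: R].
Proof. by []. Qed.

Lemma left_ideal_multiples x : left_ideal (multiples x).
Proof.
split; first by exists 0; rewrite ?mul0r.
  by move=> _ _ [r _ <-] [s _ <-]; exists (r + s); rewrite ?mulrDl.
by move=> a _ [r _ <-]; exists (a * r); rewrite ?mulrA.
Qed.

Lemma left_ideal_sum_set V W :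
  left_ideal V -> left_ideal W -> left_ideal (sum_set V W).
Proof.
move=> [V0 VD VM] [W0 WD WM]; split.
- by exists 0, 0; rewrite addr0.
- move=> _ _ [v [w [Vv Ww ->]]] [v' [w' [Vv' Ww' ->]]].
  by exists (v + v'), (w + w'); rewrite addrACA; split; auto.
- move=> a _ [v [w [Vv Ww ->]]]; exists (a * v), (a * w).
  by rewrite mulrDr; split; auto.
Qed.

Lemma left_ideal_setI V W :
  left_ideal V -> left_ideal W -> left_ideal (V `&` W).
Proof.
move=> [V0 VD VM] [W0 WD WM]; split=> [|x y [? ?] [? ?]|a x [? ?]];
  by split; auto.
Qed.

Lemma sum_setl V W : left_ideal W -> V `<=` sum_set V W.
Proof. by move=> [W0 _ _] v Vv; exists v, 0; rewrite addr0. Qed.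

Lemma sum_setr V W : left_ideal V -> W `<=` sum_set V W.
Proof. by move=> [V0 _ _] w Ww; exists 0, w; rewrite add0r. Qed.

Lemma chain_mono (V : nat -> set R) :
  (forall n, V n `<=` V n.+1) -> forall m n, (m <= n)%N -> V m `<=` V n.
Proof.
move=> V_mono m n /subnKC <-; elim: (n - m)%N => [|k IH]; first by rewrite addn0.
by rewrite addnS; apply: subset_trans IH _.
Qed.

Lemma chain_anti (V : nat -> set R) :
  (forall n, V n.+1 `<=` V n) -> forall m n, (m <= n)%N -> V n `<=` V m.
Proof.
move=> V_anti m n /subnKC <-; elim: (n - m)%N => [|k IH]; first by rewrite addn0.
by rewrite addnS; apply: subset_trans (V_anti _) _.
Qed.

Lemma left_ideal_bigcup (V : nat -> set R) :
  (forall n, left_ideal (V n)) -> (forall n, V n `<=` V n.+1) ->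
  left_ideal (\bigcup_n V n).
Proof.
move=> Vl V_mono; split.
- by exists 0%N => //; have [] := Vl 0%N.
- move=> x y [m _ Vx] [n _ Vy]; exists (maxn m n) => //.
  have [_ VD _] := Vl (maxn m n); apply: VD.
    exact: chain_mono (leq_maxl m n) _ Vx.
  exact: chain_mono (leq_maxr m n) _ Vy.
- by move=> a x [n _ Vx]; exists n => //; have [_ _ VM] := Vl n; exact: VM.
Qed.

Lemma nonzero_in V : left_ideal V -> V <> [set 0] -> exists2 x, V x & x <> 0.
Proof.
move=> Vl VN0; apply: contrapT => noV; apply: VN0.
by apply: left_ideal_eq0 => // x Vx; apply: contrapT => xN0; apply: noV; exists x.
Qed.

Lemma multiples_neq0 x : x <> 0 -> multiples x <> [set 0].
Proof.
by move=> xN0 E; apply: xN0; rewrite -[_ = 0]/([set 0] x) -E; exists 1; rewrite ?mul1r.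
Qed.

(** An infinite direct sum of cyclic submodules of R/I, with [V n] containing its
first n terms. Contrary to an independent family, such a chain passes to
subsequences, preimages and images without any reindexing of finite sums. *)
Definition extension_chain I (V : nat -> set R) (x : nat -> R) : Prop :=
  forall n, [/\ left_ideal (V n) /\ I `<=` V n, V n `<=` V n.+1,
    V n.+1 (x n), ~ I (x n) & forall r, V n (r * x n) -> I (r * x n)].

Definition finite_udim_over I : Prop :=
  ~ exists (V : nat -> set R) (x : nat -> R), extension_chain I V x.

Lemma independent_chain (L : nat -> set R) :
  (forall n, left_ideal (L n) /\ L n <> [set 0]) -> independent L ->
  exists (V : nat -> set R) (x : nat -> R), extension_chain [set 0] V x.
Proof.
move=> LP Lind.
have /choice [x xP] : forall n, exists x, L n x /\ x <> 0.
  by move=> n; have [Ll /(nonzero_in Ll)[x]] := LP n; exists x.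
pose V n := [set v | exists2 z : nat -> R,
  (forall i, L i (z i)) & v = \sum_(i < n) z i].
have L0 i : L i 0 by have [[]] := LP i.
have LD i y z : L i y -> L i z -> L i (y + z) by have [[_ H _] _] := LP i; apply: H.
have LM i a z : L i z -> L i (a * z) by have [[_ _ H] _] := LP i; apply: H.
have V0 n : V n 0 by exists (fun=> 0); rewrite ?big1.
exists V, x => n; have [Lx xN0] := xP n; split=> //.
- split; last by move=> _ ->.
  split=> // [_ _ [y Ly ->] [z Lz ->]|a _ [z Lz ->]].
    by exists (fun i => y i + z i); [auto | rewrite big_split].
  by exists (fun i => a * z i); [auto | rewrite mulr_sumr].
- move=> _ [z Lz ->]; exists (fun i => if (i < n)%N then z i else 0).
    by move=> i; case: ifP.
  rewrite big_ord_recr /= ltnn addr0.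
  by apply: eq_bigr => i _; rewrite ltn_ord.
- exists (fun i => if i == n then x i else 0).
    by move=> i; case: eqP => // ->.
  rewrite big_ord_recr /= eqxx big1 ?add0r // => i _.
  by rewrite ltn_eqF.
- move=> r [z Lz rxE]; pose z' i := if (i < n)%N then z i else - (r * x n).
  have /Lind zP : forall i : 'I_n.+1, L i (z' i).
    move=> i; rewrite /z'; case: ltnP => // leni.
    have -> : nat_of_ord i = n by apply/eqP; rewrite eqn_leq leni -ltnS ltn_ord.
    by rewrite -mulN1r; apply: (LM); apply: (LM).
  have sum0 : \sum_(i < n.+1) z' i = 0.
    rewrite big_ord_recr /= {2}/z' ltnn rxE; apply/eqP; rewrite subr_eq0.
    by apply/eqP/eq_bigr => i _; rewrite /z' ltn_ord.
  have := zP sum0 ord_max; rewrite /z' /= ltnn => /(congr1 -%R).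
  by rewrite opprK oppr0.
Qed.

Lemma chain_independent (V : nat -> set R) (x : nat -> R) :
  extension_chain [set 0] V x ->
  independent (fun n => multiples (x n)).
Proof.
move=> VP; elim=> [|n IH] z zP; first by move=> _ [].
have zV i : V n (z (widen_ord (leqnSn n) i)).
  have [r _ <-] := zP (widen_ord (leqnSn n) i); have [[[_ _ VM] _] _ _ _ _] := VP n.
  apply: VM; apply: (@chain_mono V _ i.+1) => [k||]; last by have [] := VP i.
    by have [] := VP k.
  exact: ltn_ord.
have [[Vl _] _ _ _ Vx] := VP n.
rewrite big_ord_recr /= => sum0.
have zmax0 : z ord_max = 0.
  have [r _ zE] := zP ord_max; rewrite -zE; apply: Vx.
  rewrite zE.
  have -> : z ord_max = - \sum_(i < n) z (widen_ord (leqnSn n) i).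
    by apply/eqP; rewrite -addr_eq0 addrC sum0.
  by rewrite -sub0r; apply: left_idealB; [|case: Vl|apply: left_ideal_sum].
rewrite zmax0 addr0 in sum0.
move=> i; case: (unliftP ord_max i) => [j ->|-> //].
have -> : lift ord_max j = widen_ord (leqnSn n) j.
  by apply: val_inj; rewrite /= /bump leqNgt ltn_ord.
by apply: (IH (fun j => z (widen_ord _ j))) => // k; exact: (zP (widen_ord (leqnSn n) k)).
Qed.

Lemma finite_left_udimP : finite_left_udim R <-> finite_udim_over [set 0].
Proof.
split=> fin [].
  move=> V [x VP]; apply: fin; exists (fun n => multiples (x n)).
  split; last exact: chain_independent VP.
  move=> n; split; first exact: left_ideal_multiples.
  by apply: multiples_neq0; have [] := VP n.
by move=> L [LP Lind]; apply: fin; exact: independent_chain LP Lind.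
Qed.

(** A descending chain whose successive terms fail to be essential also gives an
infinite direct sum: in a relation with terms in the [R * x n], the first term
lies in [U] one step later, hence vanishes. Descending chains arise naturally
from annihilators and from powers of an element. *)
Lemma no_descending_chain (U : nat -> set R) (x : nat -> R) :
  finite_left_udim R ->
  ~ forall n, [/\ left_ideal (U n), U n.+1 `<=` U n, U n (x n), x n <> 0 &
      forall r, U n.+1 (r * x n) -> r * x n = 0].
Proof.
move=> fin UP; apply: fin; exists (fun n => multiples (x n)); split.
  move=> n; split; first exact: left_ideal_multiples.
  by apply: multiples_neq0; have [] := UP n.
move=> n.
suff H m (z : 'I_n -> R) : (forall i : 'I_n, multiples (x (m + i)%N) (z i)) ->
    \sum_(i < n) z i = 0 -> forall i, z i = 0 by move=> z /(H 0%N).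
elim: n m z => [|n IH] m z zP; first by move=> _ [].
rewrite big_ord_recl => sum0.
have z00 : z ord0 = 0.
  have [_ _ _ _ Ux] := UP m.
  have [r _] := zP ord0; rewrite addn0 => zE; rewrite -zE; apply: Ux; rewrite zE.
  have -> : z ord0 = - \sum_(i < n) z (lift ord0 i).
    by apply/eqP; rewrite -addr_eq0 sum0.
  have [Ul _ _ _ _] := UP m.+1.
  rewrite -sub0r; apply: left_idealB => //; first by case: Ul.
  apply: left_ideal_sum => // i; have [s _ <-] := zP (lift ord0 i).
  case: (Ul) => _ _ UM; apply: UM.
  apply: (@chain_anti U _ m.+1 (m + lift ord0 i)) => [k||].
  - by have [] := UP k.
  - by rewrite /= /bump /= addnA addn1 leq_addr.
  - by have [] := UP (m + lift ord0 i)%N.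
rewrite z00 add0r in sum0.
move=> i; case: (unliftP ord0 i) => [j ->|-> //].
apply: (IH m.+1 (fun j => z (lift ord0 j))) => // k.
by have := zP (lift ord0 k); rewrite /= /bump /= addnA addn1.
Qed.

End LeftIdealTheory.

(** Classical equality, so that finitely many ideals can be listed in a sequence
with a membership predicate. *)
HB.instance Definition _ (R : pzRingType) := gen_eqMixin (ideal R).

(** * Semiprime ideals and minimal primes *)
Section IdealTheory.
Variable R : pzRingType.
Implicit Types (I J A B P : ideal R) (r x y : R).

Lemma ideal_ext I J : I = J :> set R -> I = J.
Proof.
case: I J => [I Il Ir] [J Jl Jr] /= E; rewrite E in Il Ir *.
by congr Ideal; apply: Prop_irrelevance.
Qed.

(** Passing from ideals to elements without ideals generated by elements: B is
the largest set with x R B in I, and C the set of those elements of B that carry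
B into I; C is a two-sided ideal with C C in I, and it contains x. *)
Lemma semiprime_ideal_elt I x :
  semiprime_ideal I -> (forall r, ideal_set I (x * r * x)) -> ideal_set I x.
Proof.
move=> Isp xRx.
have [I0 ID IM] := ideal_left I; have IMr := @ideal_right _ I.
pose B := [set b | forall r, ideal_set I (x * r * b)].
have Bl : left_ideal B.
  split=> [r|b c Bb Bc r|t b Bb r]; first by rewrite mulr0.
    by rewrite mulrDr; apply: ID.
  by rewrite mulrA -[_ * r * _]mulrA; apply: Bb.
have Br b t : B b -> B (b * t) by move=> Bb r; rewrite mulrA; apply: IMr.
pose C := [set c | B c /\ forall r b, B b -> ideal_set I (c * r * b)].
have Cl : left_ideal C.
  have [B0 BD BM] := Bl.
  split=> [|b c [Bb Cb] [Bc Cc]|t c [Bc Cc]]; split; [auto| |auto| |auto| ].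
  - by move=> r d _; rewrite !mul0r.
  - by move=> r d Bd; rewrite !mulrDl; apply: ID; auto.
  - by move=> r d Bd; rewrite -!mulrA; apply: IM; rewrite mulrA; auto.
have Cr c t : C c -> C (c * t).
  move=> [Bc Cc]; split; first exact: Br.
  by move=> r b Bb; rewrite -[c * t * r]mulrA; apply: Cc.
apply: (Isp (Ideal Cl Cr)) => /=; last by split=> // r b; apply.
by move=> c b [_ Cc] [Bb _]; have := Cc 1 b Bb; rewrite mulr1.
Qed.

(** With B the set of all b such that x R b lies in P, and C the set of all c
such that c R B lies in P, both are ideals, x is in C, y is in B, and C B is in
P. *)
Lemma prime_ideal_elt P x y :
  prime_ideal P -> (forall r, ideal_set P (x * r * y)) ->
  ideal_set P x \/ ideal_set P y.
Proof.
move=> [_ Ppr] xRy.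
have [P0 PD PM] := ideal_left P; have PMr := @ideal_right _ P.
pose B := [set b | forall r, ideal_set P (x * r * b)].
have Bl : left_ideal B.
  split=> [r|b c Bb Bc r|t b Bb r]; first by rewrite mulr0.
    by rewrite mulrDr; apply: PD.
  by rewrite mulrA -[_ * r * _]mulrA; apply: Bb.
have Br b t : B b -> B (b * t) by move=> Bb r; rewrite mulrA; apply: PMr.
pose C := [set c | forall r b, B b -> ideal_set P (c * r * b)].
have Cl : left_ideal C.
  split=> [r b _|b c Cb Cc r b' Bb'|t c Cc r b Bb].
  - by rewrite !mul0r.
  - by rewrite !mulrDl; apply: PD; auto.
  - by rewrite -!mulrA; apply: PM; rewrite mulrA; auto.
have Cr c t : C c -> C (c * t).
  by move=> Cc r b Bb; rewrite -[c * t * r]mulrA; apply: Cc.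
case: (Ppr (Ideal Cl Cr) (Ideal Bl Br)) => /= [c b Cc Bb|CP|BP].
- by have := Cc 1 b Bb; rewrite mulr1.
- by left; apply: CP => r b; apply.
- by right; apply: BP.
Qed.

Definition m_system (M : set R) : Prop :=
  forall u v, M u -> M v -> exists r, M (u * r * v).

Lemma prime_setC_m_system P : prime_ideal P -> m_system (~` P).
Proof.
move=> Ppr u v Pu Pv; apply: contrapT => noP.
suff /(prime_ideal_elt Ppr)[] : forall r, ideal_set P (u * r * v) by [].
by move=> r; apply: contrapT => ?; apply: noP; exists r.
Qed.

(** The terms of x, x r x, (x r x) r' (x r x), ..., where each factor r, r', ...
is chosen to avoid I, form an m-system because each term is a multiple of all the
earlier ones on both sides. *)
Lemma semiprime_m_system I x : semiprime_ideal I -> ~ ideal_set I x ->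
  exists M : set R, [/\ m_system M, M x & M `<=` ~` I].
Proof.
move=> Isp Ix.
have [||u [u0 uI uE]] :=
  @dependent_choice R (fun y => ~ ideal_set I y) (fun y z => exists r, z = y * r * y) x.
- by [].
- move=> y Iy; apply: contrapT => noy; apply: Iy.
  apply: semiprime_ideal_elt => // r; apply: contrapT => yry.
  by apply: noy; exists (y * r * y); split; last exists r.
have ul i j : (i <= j)%N -> exists t, u j = u i * t.
  move=> /subnKC <-; elim: (j - i)%N => [|k [t IH]].
    by exists 1; rewrite addn0 mulr1.
  have [r uE'] := uE (i + k)%N; rewrite addnS uE' {1}IH.
  by exists (t * r * u (i + k)%N); rewrite !mulrA.
have ur i j : (i <= j)%N -> exists t, u j = t * u i.
  move=> /subnKC <-; elim: (j - i)%N => [|k [t IH]].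
    by exists 1; rewrite addn0 mul1r.
  have [r uE'] := uE (i + k)%N; rewrite addnS uE' {2}IH.
  by exists (u (i + k)%N * r * t); rewrite !mulrA.
exists (range u); split; last 2 first.
- by exists 0%N.
- by move=> _ [n _ <-]; apply: uI.
move=> _ _ [i _ <-] [j _ <-]; have [ij|/ltnW ji] := leqP i j.
  have [t ujE] := ul _ _ ij; have [r uE'] := uE j.
  by exists (t * r), j.+1; rewrite // uE' {1}ujE !mulrA.
have [t uiE] := ur _ _ ji; have [r uE'] := uE i.
by exists (r * t), i.+1; rewrite // uE' {2}uiE !mulrA.
Qed.

Lemma maximal_m_system I x : semiprime_ideal I -> ~ ideal_set I x ->
  exists M : set R, [/\ m_system M, M x, M `<=` ~` I &
    forall N, m_system N -> N `<=` ~` I -> M `<=` N -> N `<=` M].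
Proof.
move=> Isp Ix; have [M0 [M0m M0x M0I]] := semiprime_m_system Isp Ix.
(* Zorn_bigcup includes the empty chain, so the empty m-system is admitted. *)
pose good M := [/\ m_system M, M `<=` ~` I & M !=set0 -> M x].
have [|M [[Mm MI Mx] Mmax]] := @Zorn_bigcup R good.
  move=> F Fgood Ftot; split.
  - move=> u v [M FM Mu] [N FN Nv].
    have [MN|NM] := Ftot _ _ FM FN.
      by have [/(_ u v (MN _ Mu) Nv)[r]] := Fgood _ FN; exists r, N.
    by have [/(_ u v Mu (NM _ Nv))[r]] := Fgood _ FM; exists r, M.
  - by move=> u [M FM Mu]; have [_ MI _] := Fgood _ FM; apply: MI.
  - move=> [u [M FM Mu]]; exists M => //.
    by have [_ _] := Fgood _ FM; apply; exists u.
have {}Mx : M x.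
  have [/Mx //|M_empty] := pselect (M !=set0).
  have /Mmax [] : M `<` M0.
    split=> [u Mu|/(_ x M0x) Mx']; first by case: M_empty; exists u.
    by apply: M_empty; exists x.
  by split.
exists M; split=> // N Nm NI MN; apply: contrapT => NM.
by apply: (Mmax N) => //; split=> // _; apply: MN.
Qed.

(** An ideal maximal among those over I that miss an m-system M is prime. When M
is itself maximal among the m-systems missing I, that prime is minimal over I,
because the complement of a smaller prime would be a larger m-system. *)
Lemma semiprime_minimal_prime I x : semiprime_ideal I -> ~ ideal_set I x ->
  exists P, minimal_primes I P /\ ~ ideal_set P x.
Proof.
move=> Isp Ix; have [M [Mm Mx MI Mmax]] := maximal_m_system Isp Ix.
(* As above, the empty set is admitted for the sake of the empty chain. *)
pose good (A : set R) := [/\ forall y z, A y -> A z -> A (y + z),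
  forall a y, A y -> A (a * y) /\ A (y * a), A `<=` ~` M & A !=set0 -> I `<=` A].
have [I0 ID IM] := ideal_left I; have IMr := @ideal_right _ I.
have goodI : good I by split; auto => y Iy My; apply: (MI y).
have [|A [[AD AM AMd AI] Amax]] := @Zorn_bigcup R good.
  move=> F Fgood Ftot; split.
  - move=> u v [A FA Au] [B FB Bv].
    have [AB|BA] := Ftot _ _ FA FB.
      by exists B => //; have [BD _ _ _] := Fgood _ FB; apply: BD; auto.
    by exists A => //; have [AD _ _ _] := Fgood _ FA; apply: AD; auto.
  - move=> a u [A FA Au]; have [_ AM _ _] := Fgood _ FA.
    by have [? ?] := AM a u Au; split; exists A.
  - by move=> u [A FA Au]; have [_ _ Ad _] := Fgood _ FA; apply: Ad.
  - move=> [u [A FA Au]]; have [_ _ _ AI] := Fgood _ FA.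
    by move=> z Iz; exists A => //; apply: AI => //; exists u.
have {}AI : I `<=` A.
  have [/AI //|A_empty] := pselect (A !=set0).
  have /Amax [] : A `<` I.
    split=> [u Au|/(_ 0 I0) A0]; first by case: A_empty; exists u.
    by apply: A_empty; exists 0.
  exact: goodI.
have Al : left_ideal A by split=> [|y z|a y /(AM a)[]]; auto.
have Ar y a : A y -> A (y * a) by move=> /(AM a)[].
pose P := Ideal Al Ar.
have meets B : ~ (B `<=` P) -> exists b u, [/\ ideal_set B b, A u & M (u + b)].
  move=> BP; apply: contrapT => noM.
  have [B0 BD BM] := ideal_left B; have BMr := @ideal_right _ B.
  apply: (Amax (sum_set A B)).
    split; first exact: sum_setl (ideal_left B).
    by move=> sub; apply: BP => b Bb; apply: sub; apply: sum_setr.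
  split.
  - by have [_ H _] := left_ideal_sum_set Al (ideal_left B).
  - move=> a _ [u [b [Au Bb ->]]]; have [? ?] := AM a u Au; split.
      by exists (a * u), (a * b); rewrite mulrDr; split; auto.
    by exists (u * a), (b * a); rewrite mulrDl; split; auto.
  - by move=> _ [u [b [Au Bb ->]]] Mub; apply: noM; exists b, u.
  - by move=> _; apply: subset_trans AI _; apply: sum_setl (ideal_left B).
have Ppr : prime_ideal P.
  have AMl a y : A y -> A (a * y) by move=> /(AM a)[].
  split; first by move=> A1; apply: (AMd x) => //; rewrite -[x]mulr1; apply: AMl.
  move=> B C BC; apply: contrapT => /not_orP[/meets + /meets] => -[b [u [Bb Au Mub]]].
  move=> [c [v [Cc Av Mvc]]]; have [r Mr] := Mm _ _ Mub Mvc.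
  apply: (AMd _ _ Mr); rewrite mulrDr !mulrDl.
  apply: (AD); apply: (AD).
  - exact: AMl.
  - exact: AMl.
  - by rewrite -mulrA; apply: (Ar).
  - by apply: BC => //; apply: ideal_right.
exists P; split; last by move=> Ax; exact: (AMd x).
split=> // P' P'pr IP' P'P y Ay; apply: contrapT => P'y.
apply: (AMd _ Ay); apply: (Mmax (~` P')) => //.
- exact: prime_setC_m_system.
- exact: subsetC.
- by move=> z Mz P'z; apply: (AMd z) => //; apply: P'P.
Qed.

End IdealTheory.

(** * The Goldie conditions modulo an ideal *)
Section GoldieModuloIdeal.
Variable R : pzRingType.

Definition colon (I X : set R) : set R := [set r | forall x, X x -> I (r * x)].

(** The a.c.c. on left annihilators of R/I, in terms of descending chains of
subsets of R. Left annihilators can be ordered by the sets that they annihilate,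
and this form passes to intersections of ideals. *)
Definition acc_annihilators_over (I : set R) : Prop :=
  forall X : nat -> set R, (forall n, X n.+1 `<=` X n) ->
    exists n, forall m, (n <= m)%N -> colon I (X m) `<=` colon I (X n).

Lemma factor_goldieP (I : ideal R) :
  left_goldie (factor_ring I) <-> acc_annihilators_over I /\ finite_udim_over I.
Proof.
have [I0 ID IM] := ideal_left I.
split=> [[acc /finite_left_udimP fin]|[acc fin]]; split.
- move=> X X_anti; have [||n nP] := acc (fun n => left_ann (factor_pi I @` X n)).
  + by move=> n; exists (factor_pi I @` X n).
  + by move=> n q qP _ [x Xx <-]; apply: qP; exists x => //; apply: X_anti.
  exists n => m lenm r rP x Xx.
  have : left_ann (factor_pi I @` X m) (factor_pi I r).
    by move=> _ [y Xy <-]; rewrite -rmorphM; apply/factor_pi_eq0; apply: rP.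
  rewrite nP // => /(_ (factor_pi I x)) H; apply/factor_pi_eq0; rewrite rmorphM.
  by apply: H; exists x.
- move=> [V [x VP]]; apply: fin.
  exists (fun n => factor_pi I @` V n), (fun n => factor_pi I (x n)) => n.
  have [[[V0 VD VM] IV] V_mono Vx Ix Vrx] := VP n; split.
  + split; last by move=> _ ->; exists 0; rewrite ?rmorph0.
    split; first by exists 0; rewrite ?rmorph0.
      move=> _ _ [v Vv <-] [w Vw <-].
      by exists (v + w); rewrite ?rmorphD //; apply: VD.
    move=> q _ [v Vv <-]; have [a <-] := factor_pi_surj q.
    by exists (a * v); rewrite ?rmorphM //; apply: VM.
  + by move=> _ [v Vv <-]; exists v => //; apply: V_mono.
  + by exists (x n).
  + by move=> /= /factor_pi_eq0.
  + move=> q; have [r <-] := factor_pi_surj q.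
    rewrite -rmorphM => -[v Vv /factor_pi_eq Iv].
    suff Vrxn : V n (r * x n) by apply/factor_pi_eq0; apply: Vrx.
    have -> : r * x n = v - (v - r * x n) by rewrite opprB addrC subrK.
    by apply: left_idealB => //; apply: IV.
(* The sets X n need not descend, so they are replaced by the right
   annihilators Y n of the L n, which have the same left annihilators. *)
- move=> L /choice[X LX] L_mono.
  pose Y n : set R := [set y | forall q, L n q -> q * factor_pi I y = 0].
  have [|n nP] := acc Y; first by move=> n y Yy q /L_mono; apply: Yy.
  exists n => m lenm; apply/seteqP; split; last exact: chain_mono.
  move=> q; have [r <-] := factor_pi_surj q => Lr; rewrite LX => p Xp.
  have [x xE] := factor_pi_surj p; rewrite -xE -rmorphM; apply/factor_pi_eq0.
  apply: (nP m lenm) => [y Yy|s Ls].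
    by apply/factor_pi_eq0; rewrite rmorphM; apply: Yy.
  by rewrite LX in Ls; rewrite xE; apply: Ls.
- apply/finite_left_udimP => -[V [x VP]]; apply: fin.
  have /choice[y yE] n := factor_pi_surj (x n).
  exists (fun n => factor_pi I @^-1` V n), y => n.
  have [[[V0 VD VM] _] V_mono Vx Ix Vrx] := VP n; split.
  + split; last by move=> z /factor_pi_eq0 /= ->.
    split=> [|u v Vu Vv|a v Vv] /=; first by rewrite rmorph0.
      by rewrite rmorphD; apply: VD.
    by rewrite rmorphM; apply: VM.
  + by move=> v /=; apply: V_mono.
  + by rewrite /= yE.
  + by move=> /factor_pi_eq0; rewrite yE => ?; apply: Ix.
  + move=> r; rewrite /preimage /mkset rmorphM /= yE => /Vrx rx0.
    by apply/factor_pi_eq0; rewrite rmorphM /= yE.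
Qed.

Lemma acc_annihilators_over_setI (I J : set R) :
  acc_annihilators_over I -> acc_annihilators_over J ->
  acc_annihilators_over (I `&` J).
Proof.
move=> accI accJ X X_anti.
have [[n nP] [n' n'P]] := (accI X X_anti, accJ X X_anti).
exists (maxn n n') => m; rewrite geq_max => /andP[lenm len'm] r rP x Xx.
split; [apply: (nP m lenm) | apply: (n'P m len'm)].
- by move=> y /rP[].
- exact: chain_anti (leq_maxl n n') _ Xx.
- by move=> y /rP[].
- exact: chain_anti (leq_maxr n n') _ Xx.
Qed.

(** Along a subsequence phi on which the elements r (x n) lie in J but not in I,
the left ideals I + (V n with J) form a chain modulo I: a relation modulo I
between elements of J is a relation modulo the intersection of I and J. *)
Lemma cofinal_refinement (I J : set R) (V : nat -> set R) (x : nat -> R) :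
  left_ideal I -> left_ideal J -> extension_chain (I `&` J) V x ->
  (forall m, exists n, (m <= n)%N /\ exists r, J (r * x n) /\ ~ I (r * x n)) ->
  ~ finite_udim_over I.
Proof.
move=> Il Jl VP /choice[g gP] fin; apply: fin.
pose phi k := iter k (fun n => g n.+1) (g 0%N).
have phiP k : exists r, J (r * x (phi k)) /\ ~ I (r * x (phi k)).
  by case: k => [|k]; [exact: (gP 0%N).2 | exact: (gP (phi k).+1).2].
have /choice[r rP] := phiP.
have phi_lt k : (phi k < phi k.+1)%N by have [] := gP (phi k).+1.
have V_mono m n : (m <= n)%N -> V m `<=` V n.
  by apply: chain_mono => k; have [] := VP k.
exists (fun k => sum_set I (V (phi k) `&` J)), (fun k => r k * x (phi k)) => k.
have [[Vl IV] _ Vx _ Vrx] := VP (phi k); have [Jrx Irx] := rP k.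
have VJl := left_ideal_setI Vl Jl; split=> //.
- by split; [apply: left_ideal_sum_set | apply: sum_setl].
- move=> _ [i [v [Ii [Vv Jv] ->]]]; exists i, v; split=> //; split=> //.
  by apply: V_mono Vv; apply: ltnW.
- apply: sum_setr => //; split=> //; apply: V_mono (phi_lt k) _ _.
  have [[[_ _ VM] _] _ _ _ _] := VP (phi k).+1; exact: VM.
- move=> s [i [v [Ii [Vv Jv] sE]]].
  have [_ JD JM] := Jl; have [_ VD _] := Vl.
  suff /Vrx[] : V (phi k) (s * r k * x (phi k)) by rewrite mulrA.
  rewrite -mulrA sE; apply: VD => //; apply: IV; split=> //.
  have -> : i = s * (r k * x (phi k)) - v by rewrite sE addrK.
  by apply: left_idealB => //; apply: JM.
Qed.

(** If J is not inside P, then each x n has a multiple that lies in exactly one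
of P and J: either x n itself, or some j r (x n) with j in J and outside P,
which primeness keeps outside P. One of the two cases occurs infinitely often. *)
Lemma finite_udim_over_setI (P J : ideal R) : prime_ideal P ->
  finite_udim_over P -> finite_udim_over J -> finite_udim_over (P `&` J).
Proof.
move=> Ppr finP finJ [V [x VP]].
have [Pl Jl] := (ideal_left P, ideal_left J).
have [JP|/existsNP[j /not_implyP[Jj Pj]]] := pselect (J `<=` P).
  by apply: finJ; exists V, x; rewrite -(setIidr JP).
have step n : (exists r, ideal_set J (r * x n) /\ ~ ideal_set P (r * x n)) \/
              (exists r, ideal_set P (r * x n) /\ ~ ideal_set J (r * x n)).
  have [_ _ _ PJx _] := VP n.
  have [Px|Px] := pselect (ideal_set P (x n)).
    by right; exists 1; rewrite mul1r; split=> // Jx; apply: PJx.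
  left; apply: contrapT => noJ.
  have [r|//|//] := @prime_ideal_elt _ P j (x n) Ppr.
  apply: contrapT => Pjrx; apply: noJ; exists (j * r); split=> //.
  by do 2!apply: ideal_right.
have [inJ|/existsNP[m mP]] := pselect (forall m, exists n, (m <= n)%N /\
    exists r, ideal_set J (r * x n) /\ ~ ideal_set P (r * x n)).
  exact: cofinal_refinement VP inJ finP.
rewrite setIC in VP; apply: cofinal_refinement VP _ finJ => // k.
exists (maxn m k); rewrite leq_maxr; split=> //.
have [|//] := step (maxn m k).
by move=> ?; case: mP; exists (maxn m k); rewrite leq_maxl.
Qed.

Lemma ideal_setI_right (I J : ideal R) x a :
  (I `&` J) x -> (I `&` J) (x * a).
Proof. by move=> [Ix Jx]; split; apply: ideal_right. Qed.

Definition ideal_setI (I J : ideal R) : ideal R :=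
  Ideal (left_ideal_setI (ideal_left I) (ideal_left J)) (@ideal_setI_right I J).

Definition ideal_setT : ideal R :=
  Ideal (@left_idealT R) (fun _ _ _ => Logic.I).

Lemma goldie_over_inter (ps : seq (ideal R)) :
  (forall P, P \in ps -> prime_ideal P /\ left_goldie (factor_ring P)) ->
  left_goldie (factor_ring (foldr ideal_setI ideal_setT ps)).
Proof.
move=> psP; apply/factor_goldieP; elim: ps psP => [|P ps IH] psP /=.
  split; first by move=> X _; exists 0%N.
  by move=> [V [x /(_ 0%N)[_ _ _ []]]].
have [Ppr /factor_goldieP[accP finP]] := psP P (mem_head _ _).
have [Q psQ|acc fin] := IH; first by apply: psP; rewrite inE psQ orbT.
by split; [apply: acc_annihilators_over_setI | apply: finite_udim_over_setI].
Qed.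

(** A semiprime ideal with finitely many minimal primes is their intersection, so
that the Goldie conditions modulo each of them can be intersected. *)
Lemma semiprime_factor_goldie (I : ideal R) :
  semiprime_ideal I -> finite_set (minimal_primes I) ->
  (forall P, minimal_primes I P -> left_goldie (factor_ring P)) ->
  left_goldie (factor_ring I).
Proof.
move=> Isp /finite_seqP[ps psE] gP.
have psP P : P \in ps <-> minimal_primes I P by rewrite psE.
suff -> : I = foldr ideal_setI ideal_setT ps.
  by apply: goldie_over_inter => P /psP mP; split; [case: mP | apply: gP].
apply: ideal_ext; apply/seteqP; split=> x.
  have {psE gP} : forall P, P \in ps -> I `<=` P by move=> P /psP[].
  elim: ps {psP} => //= P ps IH IP Ix; split.
    by apply: (IP P); rewrite ?mem_head.
  by apply: IH Ix => Q psQ; apply: IP; rewrite inE psQ orbT.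
move=> interx; apply: contrapT => /(semiprime_minimal_prime Isp)[P [/psP psQ Px]].
apply: Px; elim: ps psQ interx {psE psP} => //= Q ps IH.
by rewrite inE => /orP[/eqP ->[]//|/IH H [_ /H]].
Qed.

End GoldieModuloIdeal.

(** * Semisimple Artinian rings through right unit elements of left ideals *)
Section SplitLeftIdeals.
Variable Q : pzRingType.
Implicit Types L M V : set Q.

(** Such an e is idempotent and the left ideal is generated by it; thus each left
ideal is a direct summand, with complement the left annihilator of e. *)
Definition left_ideals_split : Prop :=
  forall L, left_ideal L -> exists2 e, L e & forall u, L u -> u = u * e.

(** A complement J of I is built by going through the finitely many minimal left
ideals whose sum contains 1, adding to J each one that meets I + J in zero; the
others are already inside I + J. Then e is the I-component of 1. *)
Lemma semisimple_split : semisimple Q -> left_ideals_split.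
Proof.
move=> ss I Il; have [n [L [y [LP sum1]]]] := ss 1.
have Ll i : left_ideal (L i) by have [[]] := LP i.
suff H k : (k <= n)%N -> exists2 J, left_ideal J & I `&` J `<=` [set 0] /\
    forall i : 'I_n, (i < k)%N -> L i `<=` sum_set I J.
  have [J Jl [IJ0 LIJ]] := H n (leqnn n).
  have [e [j [Ie Jj ej1]]] : sum_set I J 1.
    rewrite sum1; apply: left_ideal_sum; first exact: left_ideal_sum_set.
    by move=> i; apply: (LIJ i (ltn_ord i)); exact: (LP i).2.
  exists e => // u Iu; apply/eqP; rewrite -subr_eq0; apply/eqP/IJ0; split.
    by apply: left_idealB => //; case: Il => _ _; apply.
  have -> : u - u * e = u * j by rewrite -{1}[u]mulr1 ej1 mulrDr addrC addKr.
  by case: Jl => _ _; apply.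
elim: k => [_|k IH ltkn].
  by exists [set 0]; [exact: left_ideal0 | split=> [u []|]].
have [J Jl [IJ0 LIJ]] := IH (ltnW ltkn); pose i0 := Ordinal ltkn.
have IJl := left_ideal_sum_set Il Jl.
have [_ _ Lmin] := (LP i0).1.
have [L0|LE] := Lmin _ (left_ideal_setI (Ll i0) IJl) (@subIsetl _ _ _); last first.
  exists J => //; split=> // i; rewrite ltnS leq_eqVlt => /orP[/eqP ik|]; last exact: LIJ.
  have -> : i = i0 by exact: val_inj.
  by rewrite -LE; apply: subIsetr.
exists (sum_set J (L i0)); first exact: left_ideal_sum_set.
split=> [u [Iu [j [l [Jj Ll0 ujl]]]]|i].
  have l0 : [set 0] l.
    rewrite -L0; split=> //; exists u, (- j); split=> //.
      by rewrite -sub0r; apply: left_idealB => //; case: Jl.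
    by rewrite ujl addrAC subrr add0r.
  by apply: IJ0; split=> //; rewrite ujl (l0 : l = 0) addr0.
rewrite ltnS leq_eqVlt => /orP[/eqP ik|/LIJ Lsub].
  have -> : i = i0 by exact: val_inj.
  by apply: subset_trans (sum_setr Jl) (sum_setr Il).
by move=> u /Lsub[v [j [Iv Jj ->]]]; exists v, j; split=> //; apply: sum_setl.
Qed.

Hypothesis split : left_ideals_split.

Lemma split_acc (U : nat -> set Q) : (forall n, left_ideal (U n)) ->
  (forall n, U n `<=` U n.+1) -> exists n, forall m, U m `<=` U n.
Proof.
move=> Vl Umono; have [e [n _ Ve] eP] := split (left_ideal_bigcup Vl Umono).
exists n => m u Vu; rewrite (eP u); last by exists m.
by have [_ _ VM] := Vl n; apply: VM.
Qed.

Lemma split_finite_udim : finite_left_udim Q.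
Proof.
apply/finite_left_udimP => -[V [x VP]].
have [n|n|n nP] := @split_acc V; first by have [[]] := VP n.
  by have [] := VP n.
have [_ _ Vx xN0 Vrx] := VP n; apply: xN0; rewrite -[x n]mul1r; apply: Vrx.
by rewrite mul1r; apply: nP Vx.
Qed.

(** If e is the unit element of [U n.+1] and u lies in [U n] but not in
[U n.+1], then u - u e generates a left ideal that meets [U n.+1] in zero, so
that a strictly descending chain contradicts finite uniform dimension. *)
Lemma no_strictly_descending (U : nat -> set Q) :
  ~ forall n, [/\ left_ideal (U n), U n.+1 `<=` U n & ~ (U n `<=` U n.+1)].
Proof.
move=> UP.
suff /choice[x xP] : forall n, exists x, [/\ U n x, x <> 0 &
    forall r, U n.+1 (r * x) -> r * x = 0].
  apply: (no_descending_chain (U := U) (x := x) split_finite_udim) => n.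
  by have [[? ? _] [? ? ?]] := (UP n, xP n).
move=> n; have [[Ul U_anti UN] [U'l _ _]] := (UP n, UP n.+1).
have [e U'e eP] := split U'l.
have [u /not_implyP[Uu U'u]] : exists u, ~ (U n u -> U n.+1 u) by exact/existsNP.
exists (u - u * e); split.
- by apply: left_idealB => //; case: Ul => _ _; apply; apply: U_anti.
- move=> /eqP; rewrite subr_eq0 => /eqP uE; apply: U'u; rewrite uE.
  by case: U'l => _ _; apply.
- by move=> r /eP ->; rewrite -mulrA mulrBl -mulrA -(eP e) // subrr mulr0.
Qed.

Lemma split_artinian : left_artinian Q.
Proof.
move=> U Ul U_anti; apply: contrapT => noN.
have step k : exists m, (k <= m)%N /\ ~ (U k `<=` U m).
  apply: contrapT => nok; apply: noN; exists k => m lekm.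
  apply/seteqP; split; first exact: chain_anti.
  by apply: contrapT => UN; apply: nok; exists m.
have /choice[g gP] := step.
apply: (@no_strictly_descending (fun k => U (iter k g 0%N))) => k; split=> //.
  by apply: chain_anti => //; exact: (gP _).1.
exact: (gP _).2.
Qed.

Lemma has_minimal_left_ideal V : left_ideal V -> V <> [set 0] ->
  exists2 M, minimal_left_ideal M & M `<=` V.
Proof.
move=> Vl VN0; apply: contrapT => noM.
have [||U [_ UP UE]] := @dependent_choice (set Q)
  (fun U => [/\ left_ideal U, U <> [set 0] & U `<=` V])
  (fun U W => W `<=` U /\ ~ (U `<=` W)) V.
- by split.
- move=> U [Ul UN0 UV]; apply: contrapT => noW; apply: noM; exists U => //.
  split=> // W Wl WU; apply: contrapT => /not_orP[WN0 WNU]; apply: noW.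
  exists W; split; first by split=> //; apply: subset_trans UV.
  by split=> // UW; apply: WNU; apply/seteqP.
apply: (@no_strictly_descending U) => n.
by have [[? _ _] [? ?]] := (UP n, UE n).
Qed.

Definition socle_element (x : Q) : Prop :=
  exists (n : nat) (L : 'I_n -> set Q) (y : 'I_n -> Q),
    (forall i, minimal_left_ideal (L i) /\ L i (y i)) /\ x = \sum_(i < n) y i.

Lemma socle_element0 : socle_element 0.
Proof. by exists 0%N, (fun=> [set 0]), (fun=> 0); split=> [[]|]; rewrite ?big_ord0. Qed.

Lemma socle_elementD M x y :
  minimal_left_ideal M -> M x -> socle_element y -> socle_element (x + y).
Proof.
move=> Mmin Mx [n [L [z [LP ->]]]].
exists n.+1, (fun i => oapp L M (unlift ord0 i)), (fun i => oapp z x (unlift ord0 i)).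
split=> [i|]; first by case: unliftP => [j _|_] /=; [exact: LP | split].
rewrite big_ord_recl unlift_none; congr (_ + _).
by apply: eq_bigr => i _; rewrite liftK.
Qed.

(** A left ideal not inside the socle splits off a minimal left ideal, and its
complement is not inside the socle either; this cannot be repeated forever. *)
Lemma split_semisimple : semisimple Q.
Proof.
move=> x0; suff : [set: Q] `<=` socle_element by apply.
apply: contrapT => QN.
have [||U [_ UP UE]] := @dependent_choice (set Q)
  (fun U => left_ideal U /\ ~ (U `<=` socle_element))
  (fun U W => W `<=` U /\ ~ (U `<=` W)) [set: Q].
- by split; [exact: left_idealT|].
- move=> U [Ul UN].
  have UN0 : U <> [set 0].
    by move=> U0; apply: UN; rewrite U0 => _ ->; exact: socle_element0.
  have [M Mmin MU] := has_minimal_left_ideal Ul UN0.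
  have [Ml MN0 _] := Mmin; have [e Me eP] := split Ml.
  have [U0 UD UM] := Ul.
  exists [set u | U u /\ u * e = 0]; split; first split.
  + split=> [|u v [Uu u0] [Uv v0]|a u [Uu u0]] /=.
    * by rewrite mul0r.
    * by rewrite mulrDl u0 v0 addr0; split; auto.
    * by rewrite -mulrA u0 mulr0; split; auto.
  + move=> sub; apply: UN => u Uu.
    have -> : u = u * e + (u - u * e) by rewrite addrC subrK.
    apply: (socle_elementD Mmin); first by case: Ml => _ _; apply.
    apply: sub; split; first by apply: left_idealB => //; apply: UM; apply: MU.
    by rewrite mulrBl -mulrA -(eP e) // subrr.
  + split=> [u []//|/(_ e (MU e Me))[_ ee0]].
    apply: MN0; apply: left_ideal_eq0 => // u Mu.
    by rewrite /= (eP u Mu) (eP e Me) ee0 mulr0.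
apply: (@no_strictly_descending U) => n.
by have [[? _] [? ?]] := (UP n, UE n).
Qed.

Lemma split_semisimple_artinian : semisimple_artinian Q.
Proof. by split; [exact: split_artinian | exact: split_semisimple]. Qed.

End SplitLeftIdeals.

(** * Ideals of a semisimple Artinian localization *)
Section IdealsOfLocalization.
Variables (R Q : pzRingType) (S : set R) (f : {rmorphism R -> Q}).
Hypothesis locf : is_left_localization S f.
Implicit Types (A B : ideal R) (M N : ideal Q).

Lemma loc_denomM s t : S s -> S t -> S (s * t).
Proof. by have [[[[_ SM _] _] _] _ _ _] := locf; apply: SM. Qed.

Lemma loc_denom1 : S 1.
Proof. by have [[[[S1 _ _] _] _] _ _ _] := locf. Qed.

Lemma loc_ore r s : S s -> exists s' r', S s' /\ s' * r = r' * s.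
Proof. by have [[[_ ore] _] _ _ _] := locf; apply: ore. Qed.

Lemma loc_frac q : exists s r, S s /\ f s * q = f r.
Proof. by have [_ _ frac _] := locf. Qed.

Lemma loc_inv s : S s -> exists p, p * f s = 1 /\ f s * p = 1.
Proof. by have [_ inv _ _] := locf; apply: inv. Qed.

Lemma loc_lcan s q : S s -> f s * q = 0 -> q = 0.
Proof. by move=> /loc_inv[p [pf _]] sq0; rewrite -[q]mul1r -pf -mulrA sq0 mulr0. Qed.

Definition extension (A : set R) : set Q :=
  [set q | exists s a, [/\ S s, A a & f s * q = f a]].

Lemma extension_sub A : A `<=` f @^-1` extension A.
Proof.
move=> a Aa; exists 1, a; rewrite rmorph1 mul1r; split=> //.
exact: loc_denom1.
Qed.

Lemma extension_mono (A B : set R) : A `<=` B -> extension A `<=` extension B.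
Proof. by move=> AB q [s [a [Ss Aa E]]]; exists s, a; split=> //; apply: AB. Qed.

Lemma left_ideal_extension (A : set R) : left_ideal A -> left_ideal (extension A).
Proof.
move=> [A0 AD AM]; split.
- by exists 1, 0; rewrite rmorph0 mulr0; split=> //; exact: loc_denom1.
- move=> p q [s [a [Ss Aa pE]]] [t [b [St Ab qE]]].
  have [s' [r' [Ss' E]]] := loc_ore s St.
  exists (s' * s), (s' * a + r' * b); split; first exact: loc_denomM.
    by apply: AD; apply: AM.
  rewrite mulrDr {2}E !rmorphM rmorphD !rmorphM -!mulrA.
  by rewrite pE qE.
- move=> p q [s [a [Ss Aa qE]]]; have [t [r [St pE]]] := loc_frac p.
  have [s' [r' [Ss' E]]] := loc_ore r Ss.
  exists (s' * t), (r' * a); split; [exact: loc_denomM | exact: AM |].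
  by rewrite mulrA rmorphM -[_ * p]mulrA pE -rmorphM E !rmorphM -mulrA qE.
Qed.

Lemma left_ideal_contraction (L : set Q) : left_ideal L -> left_ideal (f @^-1` L).
Proof.
move=> [L0 LD LM]; split; rewrite /preimage /mkset.
- by rewrite rmorph0.
- by move=> x y; rewrite rmorphD; apply: LD.
- by move=> a x; rewrite rmorphM; apply: LM.
Qed.

Lemma contraction_right M x a : (f @^-1` M) x -> (f @^-1` M) (x * a).
Proof. by rewrite /preimage /mkset rmorphM; apply: ideal_right. Qed.

Definition contraction M : ideal R :=
  Ideal (left_ideal_contraction (ideal_left M)) (@contraction_right M).

Hypothesis split : left_ideals_split Q.

(** The extension E of A is stable under multiplication by f R on the right since
A is. For the inverse of f s, the left ideals of all v with v (f s)^n in E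
ascend, and their stabilization at n, applied to u (f s)^-n, shows that
u (f s) in E forces u in E. *)
Lemma extension_right A q p : extension A q -> extension A (q * p).
Proof.
have El := left_ideal_extension (ideal_left A).
have Ef a u : extension A u -> extension A (u * f a).
  move=> [s [b [Ss Ab uE]]]; exists s, (b * a).
  by rewrite mulrA uE rmorphM; split=> //; apply: ideal_right.
have Einv s u : S s -> extension A (u * f s) -> extension A u.
  move=> Ss Eus; have [t [tf ft]] := loc_inv Ss.
  have expt n : t ^+ n * f s ^+ n = 1.
    elim: n => [|n IH]; first by rewrite !expr0 mulr1.
    by rewrite exprSr exprS mulrA -(mulrA _ t) tf mulr1.
  have [||n nP] := @split_acc Q split (fun n => [set v | extension A (v * f s ^+ n)]).
  - move=> n; have [E0 ED EM] := El; split=> [|v w|a v] /=.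
    + by rewrite mul0r.
    + by rewrite mulrDl; apply: ED.
    + by rewrite -mulrA; apply: EM.
  - by move=> n v /= /(Ef s); rewrite -mulrA -exprSr.
  have := nP n.+1 (u * t ^+ n).
  by rewrite /= exprSr -!mulrA !(mulrA (t ^+ n)) expt mul1r mulr1; apply.
have [s [r [Ss pE]]] := loc_frac p; have [t [tf ft]] := loc_inv Ss => Eq.
have -> : p = t * f r by rewrite -pE mulrA tf mul1r.
rewrite mulrA; apply: (Ef); apply: Einv Ss _.
by rewrite -mulrA tf mulr1.
Qed.

Definition extended_ideal A : ideal Q :=
  Ideal (left_ideal_extension (ideal_left A)) (@extension_right A).

(** The denominator of q is moved into p, which is possible because the extension
of A is a right ideal. *)
Lemma extension_mul A B p q : extension A p -> extension B q ->
  exists s a b, [/\ S s, ideal_set A a, ideal_set B b & f s * (p * q) = f (a * b)].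
Proof.
move=> Ap [t [b [St Bb qE]]]; have [u [uf fu]] := loc_inv St.
have [s [a [Ss Aa E]]] := extension_right u Ap.
exists s, a, b; split=> //.
by rewrite rmorphM -qE -E -!mulrA (mulrA u) uf mul1r.
Qed.

(** If A A is inside the kernel, then the extension of A squares to zero, and so
does its unit element e, whence e = e e = 0. *)
Lemma semiprime_kernel (a : ideal R) :
  (forall r, f r = 0 <-> ideal_set a r) -> semiprime_ideal a.
Proof.
move=> aP A AA; have [e Ee eP] := split (left_ideal_extension (ideal_left A)).
have e0 : e = 0.
  have [s [x [y [Ss Ax Ay]]]] := extension_mul Ee Ee.
  rewrite -(eP e Ee) => E; apply: (loc_lcan Ss).
  by rewrite E; apply/aP/AA.
move=> x Ax; apply/aP.
by rewrite (eP (f x) (extension_sub Ax)) e0 mulr0.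
Qed.

Lemma contraction_prime M : prime_ideal M -> prime_ideal (contraction M).
Proof.
move=> [M1 Mpr]; split; first by rewrite /= /preimage /mkset rmorph1.
move=> A B AB; have [[M0 MD MM] Mr] := (ideal_left M, @ideal_right _ M).
have [p q Ap Bq|AM|BM] := Mpr (extended_ideal A) (extended_ideal B).
- have [s [a [b [Ss Aa Bb E]]]] := extension_mul Ap Bq.
  have [t [tf ft]] := loc_inv Ss.
  rewrite -[p * q]mul1r -tf -mulrA E; apply: MM; exact: AB.
- by left=> a /extension_sub /AM.
- by right=> b /extension_sub /BM.
Qed.

Lemma left_ideal_add M N : left_ideal (sum_set M N).
Proof. exact: left_ideal_sum_set (ideal_left M) (ideal_left N). Qed.

Lemma ideal_add_right M N x a : sum_set M N x -> sum_set M N (x * a).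
Proof.
move=> [m [n [Mm Nn ->]]]; exists (m * a), (n * a).
by rewrite mulrDl; split=> //; apply: ideal_right.
Qed.

Definition ideal_add M N : ideal Q := Ideal (@left_ideal_add M N) (@ideal_add_right M N).

(** The consequence needed of the fact that N contains a product of finitely many
primes over N; it speaks of contractions because a prime of R need not be
the contraction of a prime of Q. *)
Definition prime_cover N : Prop :=
  exists Ms : seq (ideal Q),
    (forall M, M \in Ms -> prime_ideal M /\ N `<=` M) /\
    forall P : ideal R, prime_ideal P -> f @^-1` N `<=` P ->
      exists2 M, M \in Ms & f @^-1` M `<=` P.

(** Noetherian induction: if N is proper and not prime, witnessed by A and B with
A B inside N, then the lists for the larger ideals N + A and N + B together serve
for N. *)
Lemma prime_cover_all N : prime_cover N.
Proof.
apply: contrapT => noN.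
have [//||U [_ UP UE]] := @dependent_choice (ideal Q)
  (fun N => ~ prime_cover N) (fun N N' => N `<=` N' /\ ~ (N' `<=` N)) N; last first.
  have [||n nP] := @split_acc Q split (fun n => U n : set Q).
  - by move=> n; apply: ideal_left.
  - by move=> n; have [] := UE n.
  by have [_] := UE n; apply; apply: nP.
move=> {}N {}noN; apply: contrapT => noN'.
have [N0 ND NM] := ideal_left N; have Nr := @ideal_right _ N.
have Nproper : ~ ideal_set N 1.
  move=> N1; apply: noN; exists [::]; split=> // P [P1 _] NP.
  by case: P1; apply: NP; rewrite /preimage /mkset rmorph1.
have [AB] : exists AB : ideal Q * ideal Q,
    [/\ forall a b, ideal_set AB.1 a -> ideal_set AB.2 b -> ideal_set N (a * b),
        ~ (AB.1 `<=` N) & ~ (AB.2 `<=` N)].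
  apply: contrapT => noAB; apply: noN; exists [:: N]; split.
    move=> M; rewrite inE => /eqP ->; split=> //; split=> // A B AB.
    by apply: contrapT => /not_orP[AN BN]; apply: noAB; exists (A, B).
  by move=> P _ NP; exists N; rewrite ?inE.
case: AB => A B /= [AB AN BN].
have larger (C : ideal Q) : ~ (C `<=` N) -> prime_cover (ideal_add N C).
  move=> CN; apply: contrapT => noC; apply: noN'; exists (ideal_add N C).
  split=> //; split; first exact: sum_setl (ideal_left C).
  by move=> NCN; apply: CN => c Cc; apply: NCN; apply: sum_setr (ideal_left N) _ _.
have [[Ms [MsP MsC]] [Ns [NsP NsC]]] := (larger A AN, larger B BN).
apply: noN; exists (Ms ++ Ns); split.
  move=> M; rewrite mem_cat => /orP[/MsP[Mpr sub]|/NsP[Mpr sub]]; split=> //.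
    by apply: subset_trans sub; apply: sum_setl (ideal_left A).
  by apply: subset_trans sub; apply: sum_setl (ideal_left B).
move=> P Ppr NP.
have [x y [n [a [Nn Aa xE]]] [n' [b [Nn' Bb yE]]]||] :=
    Ppr.2 (contraction (ideal_add N A)) (contraction (ideal_add N B)).
- apply: NP; rewrite /preimage /mkset rmorphM xE yE mulrDr !mulrDl.
  by apply: (ND); apply: (ND); [apply: Nr | apply: NM | apply: Nr | apply: AB].
- by move=> /(MsC _ Ppr)[M MMs sub]; exists M; rewrite // mem_cat MMs.
- by move=> /(NsC _ Ppr)[M MNs sub]; exists M; rewrite // mem_cat MNs orbT.
Qed.

(** A chain in R that witnesses the failure of either condition extends to an
ascending chain of left ideals of Q, which stabilizes. *)
Lemma contraction_goldie M : left_goldie (factor_ring (contraction M)).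
Proof.
have [M0 MD MM] := ideal_left M; apply/factor_goldieP; split.
- move=> X X_anti.
  have [||n nP] := @split_acc Q split
    (fun n => [set q | forall x, X n x -> ideal_set M (q * f x)]).
  + move=> n; split=> [x _|p q Mp Mq x Xx|a q Mq x Xx]; first by rewrite mul0r.
      by rewrite mulrDl; apply: MD; auto.
    by rewrite -mulrA; apply: MM; apply: Mq.
  + by move=> n q Mq x /X_anti; apply: Mq.
  exists n => m _ r rP x Xx; rewrite /= /preimage /mkset rmorphM.
  by apply: (nP m) => // y Xy; have := rP y Xy; rewrite /= /preimage /mkset rmorphM.
- move=> [V [x VP]].
  have [||n nP] := @split_acc Q split (fun n => extension (V n)).
  + by move=> n; apply: left_ideal_extension; have [[]] := VP n.
  + by move=> n; apply: extension_mono; have [] := VP n.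
  have [[Vl MV] _ Vx Mx Vrx] := VP n.
  have : extension (V n) (f (x n)).
    apply: (nP n.+1); exists 1, (x n);
    by rewrite rmorph1 mul1r; split=> //; exact: loc_denom1.
  move=> [s [v [Ss Vv sxv]]].
  have Vsx : V n (s * x n).
    rewrite -(subrK v (s * x n)); case: (Vl) => _ VD _; apply: VD => //.
    by apply: MV; rewrite /= /preimage /mkset rmorphB rmorphM sxv subrr.
  apply: Mx; have := Vrx s Vsx; rewrite /= /preimage /mkset rmorphM.
  have [t [tf ft]] := loc_inv Ss => /(MM t).
  by rewrite mulrA tf mul1r.
Qed.

Lemma minimal_prime_contracted (a : ideal R) :
  (forall r, f r = 0 <-> ideal_set a r) ->
  exists Ms : seq (ideal Q), forall P, minimal_primes a P ->
    exists2 M, M \in Ms & P = contraction M.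
Proof.
move=> aP; have ideal0r (x b : Q) : [set 0] x -> [set 0] (x * b).
  by move=> ->; rewrite /= mul0r.
have [Ms [MsP MsC]] := prime_cover_all (Ideal (@left_ideal0 Q) ideal0r).
exists Ms => P [Ppr aP' Pmin].
have [x /aP /aP'//|M MMs MP] := MsC P Ppr.
exists M => //; apply: ideal_ext; apply/seteqP; split=> //.
have [Mpr _] := MsP M MMs; apply: (Pmin (contraction M)) => //.
  exact: contraction_prime.
move=> x /aP fx0; rewrite /= /preimage /mkset fx0.
by have [] := ideal_left M.
Qed.

(** Right multiplication by f c is injective on Q; since Q is Artinian,
(f c)^n = q (f c)^(n+1) for some n and q, and cancelling gives q (f c) = 1. A
numerator of q is the required r. *)
Lemma regular_divides_denominator (a : ideal R) c : left_artinian Q ->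
  (forall r, f r = 0 <-> ideal_set a r) ->
  (forall x, ideal_set a (x * c) -> ideal_set a x) ->
  exists r, exists2 s, S s & f (r * c) = f s.
Proof.
move=> art aP creg.
have fc_reg q : q * f c = 0 -> q = 0.
  have [s [r [Ss qE]]] := loc_frac q => qc0; apply: (loc_lcan Ss).
  by rewrite qE; apply/aP/creg/aP; rewrite rmorphM -qE -mulrA qc0 mulr0.
have fcX_reg n q : q * f c ^+ n = 0 -> q = 0.
  elim: n => [|n IH]; first by rewrite expr0 mulr1.
  by rewrite exprSr mulrA => /fc_reg.
have [|n|n nP] := art (fun n => multiples (f c ^+ n)).
- by move=> n; apply: left_ideal_multiples.
- by move=> _ [r _ <-]; exists (r * f c); rewrite // exprS mulrA.
have : multiples (f c ^+ n.+1) (f c ^+ n).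
  by rewrite nP //; exists 1; rewrite ?mul1r.
move=> [q _ qE]; have qc1 : q * f c = 1.
  apply/eqP; rewrite -subr_eq0; apply/eqP/(fcX_reg n).
  by rewrite mulrBl mul1r -mulrA -exprS qE subrr.
have [s [r [Ss sq]]] := loc_frac q; exists r, s => //.
by rewrite rmorphM -sq -mulrA qc1 mulr1.
Qed.

End IdealsOfLocalization.

(** * Goldie's theorem for semiprime left Goldie rings *)
Section GoldieTheorem.
Variable T : pzRingType.
Implicit Types (K L V : set T) (a b c r s x y : T).

Definition essential V : Prop :=
  forall y, y <> 0 -> exists r, V (r * y) /\ r * y <> 0.

Definition kills c : set T := [set r | r * c = 0].

Lemma left_ideal_kills c : left_ideal (kills c).
Proof.
split=> [|x y|t x]; rewrite /kills /mkset; first by rewrite mul0r.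
  by rewrite mulrDl => -> ->; rewrite addr0.
by rewrite -mulrA => ->; rewrite mulr0.
Qed.

Hypothesis semiprime : forall x, (forall r, x * r * x = 0) -> x = 0.
Hypothesis goldie : left_goldie T.

Lemma kills_chain_stops (c : nat -> T) :
  (forall n, kills (c n) `<=` kills (c n.+1)) ->
  exists n, kills (c n.+1) `<=` kills (c n).
Proof.
move=> c_mono; have [||n nP] := goldie.1 (fun n => kills (c n)) => //.
  by move=> n; exists [set c n]; apply/seteqP; split=> [r rc _ ->|r]; last exact.
by exists n; rewrite nP.
Qed.

Lemma kills_power_stops b : exists n, kills (b ^+ n.+1) `<=` kills (b ^+ n).
Proof.
apply: kills_chain_stops => n r.
by rewrite /kills /mkset exprSr mulrA => ->; rewrite mul0r.
Qed.

Lemma mul_expr_swap a b n : a * (b * a) ^+ n = (a * b) ^+ n * a.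
Proof.
by elim: n => [|n IH]; rewrite ?mulr1 ?mul1r // exprSr mulrA IH exprSr -!mulrA.
Qed.

(** The right ideal b T is nil too. Let a be nonzero in b T with maximal left
annihilator among the nonzero elements a x. If a x a were nonzero, let k be least
with (a x)^(k+1) a = 0. The element (a x)^k a is a nonzero multiple of a,
so it has the same left annihilator as a; as a x kills it, a x a = 0. Thus
a T a = 0, against semiprimeness. *)
Lemma nil_left_ideal0 b : (forall r, exists n, (r * b) ^+ n = 0) -> b = 0.
Proof.
move=> nilTb; apply: contrapT => bN0.
have nilbT x : exists n, (b * x) ^+ n = 0.
  have [n xbn] := nilTb x; exists n.+1.
  by rewrite exprSr mulrA -mul_expr_swap xbn mulr0 mul0r.
have [a [[z az] aN0] amax] : exists2 a, (exists z, a = b * z) /\ a <> 0 &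
    forall x, a * x <> 0 -> kills (a * x) `<=` kills a.
  apply: contrapT => noa.
  have [||u [_ uP uE]] := @dependent_choice T
    (fun a => (exists z, a = b * z) /\ a <> 0)
    (fun a a' => exists2 x, a' = a * x & ~ (kills a' `<=` kills a)) b.
  - by split=> //; exists 1; rewrite mulr1.
  - move=> a [[z az] aN0]; apply: contrapT => noa'; apply: noa; exists a.
      by split=> //; exists z.
    move=> x axN0; apply: contrapT => notmax; apply: noa'; exists (a * x).
    by split; [split=> //; exists (z * x); rewrite az mulrA | exists x].
  have [n r|n nP] := @kills_chain_stops u.
    by have [x -> _] := uE n; rewrite /kills /mkset mulrA => ->; rewrite mul0r.
  by have [x _] := uE n; apply.
apply: aN0; apply: semiprime => x; apply: contrapT => axaN0.
have [k axk] : exists k, (a * x) ^+ k * a = 0.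
  have [k E] := nilbT (z * x); exists k.
  by rewrite {1}az -mulrA E mul0r.
elim: k axk => [|k IH]; first by rewrite mul1r => a0; apply: axaN0; rewrite a0 mulr0.
rewrite exprS -!mulrA mulrA => axk; apply: IH; apply: contrapT => akN0.
rewrite -mul_expr_swap in akN0 axk.
by apply: axaN0; apply: (amax ((x * a) ^+ k)).
Qed.

(** Each multiple z of x has an essential left annihilator again, and if the left
annihilators of z^n and z^(n+1) agree, then T z^n meets that of z in zero; so z is
nilpotent, and the left ideal of x is nil. *)
Lemma nonsingular x : essential (kills x) -> x = 0.
Proof.
move=> xess; apply: nil_left_ideal0 => r.
have rxess : essential (kills (r * x)).
  move=> y yN0; have [yr0|yrN0] := pselect (y * r = 0).
    by exists 1; rewrite mul1r /kills /mkset mulrA yr0 mul0r.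
  have [t [tyrx tyrN0]] := xess _ yrN0; exists t; split.
    by rewrite /kills /mkset mulrA -(mulrA t).
  by move=> ty0; apply: tyrN0; rewrite mulrA ty0 mul0r.
have [n nP] := kills_power_stops (r * x); exists n; apply: contrapT => zN0.
have [t [tz tzN0]] := rxess _ zN0; apply: tzN0.
by apply: nP; rewrite /kills /mkset exprSr mulrA.
Qed.

(** Otherwise T y meets T c in zero for some nonzero y, and the y c^n generate an
infinite direct sum. *)
Lemma left_regular_essential c : left_regular T c -> essential (multiples c).
Proof.
move=> creg y yN0; apply: contrapT => noy.
have cXreg n z : z * c ^+ n = 0 -> z = 0.
  by elim: n => [|n IH]; rewrite ?mulr1 // exprSr mulrA => /creg.
apply: (no_descending_chain (U := fun n => multiples (c ^+ n))
  (x := fun n => y * c ^+ n) goldie.2) => n; split.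
- exact: left_ideal_multiples.
- by move=> _ [r _ <-]; exists (r * c); rewrite // exprS mulrA.
- by exists y.
- by move=> /cXreg.
- move=> r [s _ sE]; rewrite mulrA; suff -> : r * y = 0 by rewrite mul0r.
  apply: contrapT => ryN0; apply: noy; exists r; split=> //; exists s => //.
  apply/eqP; rewrite -subr_eq0; apply/eqP/(cXreg n).
  by rewrite mulrBl -mulrA -exprS sE mulrA subrr.
Qed.

(** If c x = 0, then the left annihilator of x contains the essential left ideal
T c. *)
Lemma left_regular_regular c : left_regular T c -> regular T c.
Proof.
move=> creg; split=> // x cx0; apply: nonsingular => y yN0.
have [r [[s _ sc] ryN0]] := left_regular_essential creg yN0.
by exists r; rewrite /kills /mkset -sc -mulrA cx0 mulr0 sc.
Qed.

(** A high enough power of a non-nilpotent element of L. *)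
Lemma square_stable_element L : left_ideal L -> L <> [set 0] ->
  exists a, [/\ L a, a <> 0 & forall r, r * a * a = 0 -> r * a = 0].
Proof.
move=> Ll /(nonzero_in Ll)[b Lb bN0].
have [r rnil] : exists r, forall n, (r * b) ^+ n <> 0.
  apply: contrapT => nor; apply: bN0; apply: nil_left_ideal0 => r.
  by apply: contrapT => non; apply: nor; exists r => n zn; apply: non; exists n.
have [n nP] := kills_power_stops (r * b); set z := r * b in rnil nP.
have Lz : L z by case: Ll => _ _; apply.
have stable k s : s * z ^+ (n + k) = 0 -> s * z ^+ n = 0.
  elim: k => [|k IH]; first by rewrite addn0.
  rewrite -addSnnS addnC exprD mulrA => /nP.
  by rewrite /kills /mkset -mulrA -exprD addnC.
exists (z ^+ n.+1); split=> // [|s szz].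
  by rewrite exprSr; case: Ll => _ _; apply.
rewrite exprSr mulrA (stable n.+2) ?mul0r //.
by rewrite -addSnnS exprD mulrA.
Qed.

(** Elements c of L with the same left annihilator as their square are improved
by adding an element a of L that c kills on the right: since a c = 0, the left
annihilator of c + a is the intersection of those of c and a. The left ideals
of the elements of L killed by c then descend without being essential in each
other, so the process ends with a c whose left annihilator meets L in zero. *)
Lemma essential_left_regular L :
  left_ideal L -> essential L -> exists2 c, L c & left_regular T c.
Proof.
move=> Ll Less; have [L0 LD LM] := Ll.
have [c [Lc cstable cL]] : exists c, [/\ L c, kills (c * c) `<=` kills c &
    L `&` kills c `<=` [set 0]].
  apply: contrapT => noc.
  pose good c := L c /\ kills (c * c) `<=` kills c.
  pose next c c' := exists a, [/\ L a /\ a <> 0, a * c = 0,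
    kills c' `<=` kills c & kills c' `<=` kills a] /\
    forall r, r * a * a = 0 -> r * a = 0.
  have [||c [_ cP cE]] := @dependent_choice T good next 0.
  - by split=> // r _; rewrite /kills /mkset mulr0.
  - move=> c [Lc cc].
    have LKl : left_ideal (L `&` kills c).
      exact: left_ideal_setI Ll (left_ideal_kills c).
    have LKN0 : L `&` kills c <> [set 0].
      by move=> E; apply: noc; exists c; split=> //; rewrite E.
    have [a [[La ac] aN0 astable]] := square_stable_element LKl LKN0.
    (* Multiplying r c = - r a by c on the right turns the right side into 0. *)
    have killD r : r * (c + a) = 0 -> r * c = 0 /\ r * a = 0.
      rewrite mulrDr => rca; suff rc : r * c = 0 by rewrite rc add0r in rca.
      apply: cc; rewrite /kills /mkset mulrA; move/(congr1 ( *%R^~ c)): rca.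
      by rewrite /= mulrDl -(mulrA r a) ac mulr0 addr0 mul0r.
    exists (c + a); split; last first.
      by exists a; split=> //; split=> // r /killD[].
    split=> [|r]; first exact: LD.
    rewrite /kills /mkset mulrA => /killD[].
    rewrite !mulrDr !mulrDl -!(mulrA r a c) ac mulr0 addr0 => rcc.
    have rc : r * c = 0 by apply: cc; rewrite /kills /mkset mulrA.
    by rewrite rc mul0r !add0r => /astable.
  have /choice[a aP] := cE.
  apply: (no_descending_chain (U := fun n => L `&` kills (c n)) (x := a) goldie.2).
  move=> n; have [[[La aN0] ac cc ca] astable] := aP n; split=> //.
  - exact: left_ideal_setI Ll (left_ideal_kills (c n)).
  - by move=> r [Lr /cc].
  - by move=> r [_ /ca]; apply: astable.
exists c => // y yc; apply: contrapT => yN0.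
have [r [Lry]] := Less y yN0; apply; apply: cL; split=> //.
by rewrite /kills /mkset -mulrA yc mulr0.
Qed.

(** The left ideal of all t with t r in T c is essential because T c is. *)
Lemma goldie_ore r c : regular T c ->
  exists c' r', regular T c' /\ c' * r = r' * c.
Proof.
move=> [creg _]; pose K := [set t | multiples c (t * r)].
have Kl : left_ideal K.
  have [C0 CD CM] := left_ideal_multiples c.
  split=> [|x y|t x]; rewrite /K /mkset.
  + by rewrite mul0r.
  + by rewrite mulrDl; apply: CD.
  + by rewrite -mulrA; apply: CM.
have Kess : essential K.
  move=> y yN0; have [yr0|yrN0] := pselect (y * r = 0).
    by exists 1; rewrite mul1r; split=> //; exists 0; rewrite ?mul0r ?yr0.
  have [t [Ct tyrN0]] := left_regular_essential creg yrN0; exists t; split.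
    by rewrite /K /mkset -mulrA.
  by move=> ty0; apply: tyrN0; rewrite mulrA ty0 mul0r.
have [c' [r' _ E] c'reg] := essential_left_regular Kl Kess.
by exists c', r'; split; [exact: left_regular_regular | rewrite E].
Qed.

(** As long as L + J is not essential, J can be enlarged by some T x that meets
L + J in zero; this stops by finite uniform dimension. *)
Lemma essential_complement L : left_ideal L ->
  exists J, [/\ left_ideal J, L `&` J `<=` [set 0] & essential (sum_set L J)].
Proof.
move=> Ll; apply: contrapT => noJ.
pose good J := left_ideal J /\ L `&` J `<=` [set 0].
pose next J J' := exists x, [/\ J `<=` J', J' x, x <> 0 &
  forall r, sum_set L J (r * x) -> r * x = 0].
have [||J [_ JP JE]] := @dependent_choice (set T) good next [set 0].
- by split; [exact: left_ideal0 | move=> x []].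
- move=> J [Jl LJ0].
  have [x [xN0 xP]] : exists x, x <> 0 /\
      forall r, sum_set L J (r * x) -> r * x = 0.
    apply: contrapT => nox; apply: noJ; exists J; split=> // y yN0.
    apply: contrapT => noy; apply: nox; exists y; split=> // r LJ.
    by apply: contrapT => ryN0; apply: noy; exists r.
  have xl := left_ideal_multiples x.
  exists (sum_set J (multiples x)); split; last first.
    exists x; split=> //; first exact: sum_setl.
    by apply: sum_setr => //; exists 1; rewrite ?mul1r.
  split; first exact: left_ideal_sum_set.
  move=> y [+ [j [_ [Jj [r _ <-] yE]]]]; rewrite yE => {y yE} Ly.
  have rx0 : r * x = 0.
    apply: xP; exists (j + r * x), (- j); split=> //.
      by rewrite -sub0r; apply: left_idealB => //; case: Jl.
    by rewrite addrAC subrr add0r.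
  by apply: LJ0; split=> //; rewrite rx0 addr0.
have /choice[x xP] := JE.
have /finite_left_udimP[] := goldie.2; exists J, x => n.
have [[Jl LJ0] [JJ' Jx xN0 Jrx]] := (JP n, xP n); split=> //.
- by split=> // _ ->; case: Jl.
- by move=> r Jr; apply: Jrx; apply: sum_setr.
Qed.

End GoldieTheorem.

(** * The ring of left fractions at an Ore set of regular elements *)
Record ore_set (T : pzRingType) := OreSet {
  denominator :> set T;
  denominator1 : denominator 1;
  denominatorM : forall s t, denominator s -> denominator t -> denominator (s * t);
  denominator_ore : forall r s, denominator s ->
    exists s' r', denominator s' /\ s' * r = r' * s;
  denominator_regular : denominator `<=` regular T
}.

Section Fractions.
Variables (T : pzRingType) (S : ore_set T).
Implicit Types (s t x y z : T) (H : T -> T -> Prop).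

Record partial_hom H : Prop := PartialHom {
  partial_homD : forall x y x' y', H x y -> H x' y' -> H (x + x') (y + y');
  partial_homM : forall a x y, H x y -> H (a * x) (a * y);
  partial_hom_fun : forall y, H 0 y -> y = 0;
  partial_hom_dom : exists s y, denominator S s /\ H s y
}.

Definition saturated H : Prop :=
  forall s x y, denominator S s -> H (s * x) (s * y) -> H x y.

(** The fraction q = s^-1 a is represented by the relation x q = y between
elements of T, that is, by the homomorphism of right multiplication by q with the
largest possible domain. Fractions then add and compose as homomorphisms, so
that the operations are defined without any choice of representatives. *)
Record fraction := Fraction {
  graph : T -> T -> Prop;
  graph_hom : partial_hom graph;
  graph_saturated : saturated graph
}.
Implicit Types p q r : fraction.

Lemma hom_dom_mul H y : partial_hom H ->
  exists s z, denominator S s /\ H (s * y) z.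
Proof.
move=> Hh; have [t [z [St Htz]]] := partial_hom_dom Hh.
have [s [a [Ss E]]] := denominator_ore y St.
by exists s, (a * z); rewrite E; split=> //; apply: partial_homM.
Qed.

Lemma hom_inj H x y z : partial_hom H -> H x y -> H x z -> y = z.
Proof.
move=> Hh Hy Hz; apply/eqP; rewrite -subr_eq0; apply/eqP/(partial_hom_fun Hh).
rewrite -(subrr x) -(mulN1r x) -(mulN1r z).
by apply: partial_homD => //; apply: partial_homM.
Qed.

(** Two fractions that agree at one denominator are equal: every x has a left
multiple t x = a s with t a denominator, and saturation removes t. Each identity
in the ring of fractions is checked at a single denominator. *)
Lemma fraction_eq p q s y :
  denominator S s -> graph p s y -> graph q s y -> p = q.
Proof.
move=> Ss ps qs.
have sub p' q' : graph p' s y -> graph q' s y ->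
    forall x z, graph p' x z -> graph q' x z.
  move=> p's q's x z p'x; have [t [a [St E]]] := denominator_ore x Ss.
  apply: (graph_saturated St); have := partial_homM (graph_hom q') a q's.
  rewrite -E; have := partial_homM (graph_hom p') a p's; rewrite -E => H1.
  by rewrite (hom_inj (graph_hom p') (partial_homM (graph_hom p') t p'x) H1).
have E : graph p = graph q.
  apply/funext => x; apply/funext => z; apply/propext.
  by split; apply: sub.
case: p q E {ps qs sub} => [g gh gs] [g' gh' gs'] /= E; rewrite -E in gh' gs' *.
by congr Fraction; apply: Prop_irrelevance.
Qed.

(** The largest extension of H: the domain of a sum or of a composite of two
homomorphisms has to be enlarged in this way. *)
Definition saturation H x y : Prop :=
  exists s, denominator S s /\ H (s * x) (s * y).

Lemma saturation_hom H : partial_hom H -> partial_hom (saturation H).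
Proof.
move=> Hh; split.
- move=> x y x' y' [s [Ss Hx]] [t [St Hx']].
  have [s' [t' [Ss' E]]] := denominator_ore s St.
  exists (s' * s); split; first exact: denominatorM.
  rewrite !mulrDr; apply: (partial_homD Hh).
    by rewrite -!(mulrA s'); apply: partial_homM.
  by rewrite E -!(mulrA t'); apply: partial_homM.
- move=> a x y [s [Ss Hx]].
  have [s' [a' [Ss' E]]] := denominator_ore a Ss.
  exists s'; split=> //; rewrite !mulrA E -!mulrA.
  exact: partial_homM.
- move=> y [s [Ss]]; rewrite mulr0 => /(partial_hom_fun Hh).
  exact: (denominator_regular Ss).2.
- have [s [y [Ss Hs]]] := partial_hom_dom Hh; exists s, y; split=> //.
  by exists 1; rewrite !mul1r; split=> //; apply: denominator1.
Qed.

Lemma saturation_saturated H : saturated (saturation H).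
Proof.
move=> s x y Ss [t [St Hx]]; exists (t * s).
by split; [exact: denominatorM | rewrite -!mulrA].
Qed.

Definition fraction_of H (Hh : partial_hom H) : fraction :=
  Fraction (saturation_hom Hh) (@saturation_saturated H).

Lemma fraction_ofE H (Hh : partial_hom H) x y :
  H x y -> graph (fraction_of Hh) x y.
Proof. by exists 1; rewrite !mul1r; split=> //; apply: denominator1. Qed.

Lemma const_hom a : partial_hom (fun x y => y = x * a).
Proof.
split=> [x _ x' _ -> ->|b x _ ->|_ ->|]; rewrite ?mulrDl ?mulrA ?mul0r //.
by exists 1, (1 * a); split=> //; apply: denominator1.
Qed.

Lemma add_hom p q : partial_hom (fun x y =>
  exists u v, [/\ graph p x u, graph q x v & y = u + v]).
Proof.
have [ph qh] := (graph_hom p, graph_hom q); split.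
- move=> x _ x' _ [u [v [pu qv ->]]] [u' [v' [pu' qv' ->]]].
  by exists (u + u'), (v + v'); rewrite addrACA; split=> //; apply: partial_homD.
- move=> a x _ [u [v [pu qv ->]]].
  by exists (a * u), (a * v); rewrite mulrDr; split=> //; apply: partial_homM.
- by move=> _ [u [v [/(partial_hom_fun ph)-> /(partial_hom_fun qh)-> ->]]]; rewrite addr0.
- have [s [u [Ss pu]]] := partial_hom_dom ph.
  have [t [v [St qv]]] := hom_dom_mul s qh.
  exists (t * s), (t * u + v); split; first exact: denominatorM.
  by exists (t * u), v; split=> //; apply: partial_homM.
Qed.

Lemma mul_hom p q : partial_hom (fun x z => exists2 y, graph p x y & graph q y z).
Proof.
have [ph qh] := (graph_hom p, graph_hom q); split.
- move=> x z x' z' [y py qz] [y' py' qz'].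
  by exists (y + y'); apply: partial_homD.
- by move=> a x z [y py qz]; exists (a * y); apply: partial_homM.
- by move=> z [y /(partial_hom_fun ph)-> /(partial_hom_fun qh)].
- have [s [u [Ss pu]]] := partial_hom_dom ph.
  have [t [v [St qv]]] := hom_dom_mul u qh.
  exists (t * s), v; split; first exact: denominatorM.
  by exists (t * u) => //; apply: partial_homM.
Qed.

(** The inverse of the fraction a / 1, for a denominator a. *)
Lemma div_hom a : denominator S a -> partial_hom (fun x y => x = y * a).
Proof.
move=> Sa; split=> [_ y _ y' -> ->|b _ y ->|y|]; rewrite ?mulrDl ?mulrA //.
  by move/esym/(denominator_regular Sa).1.
by exists a, 1; rewrite mul1r.
Qed.

Definition fraction_const a := fraction_of (const_hom a).
Definition fraction_add p q := fraction_of (add_hom p q).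
Definition fraction_mul p q := fraction_of (mul_hom p q).
Definition fraction_opp p := fraction_mul p (fraction_const (- 1)).

Lemma graph_const a x y : y = x * a -> graph (fraction_const a) x y.
Proof. exact: fraction_ofE. Qed.

Lemma graph_add p q x u v :
  graph p x u -> graph q x v -> graph (fraction_add p q) x (u + v).
Proof. by move=> pu qv; apply: fraction_ofE; exists u, v. Qed.

Lemma graph_mul p q x y z :
  graph p x y -> graph q y z -> graph (fraction_mul p q) x z.
Proof. by move=> py qz; apply: fraction_ofE; exists y. Qed.

Lemma graph_opp p x y : graph p x y -> graph (fraction_opp p) x (- y).
Proof. by move=> py; apply: graph_mul py _; apply: graph_const; rewrite mulrN1. Qed.

Lemma graphM p a x y : graph p x y -> graph p (a * x) (a * y).
Proof. exact: partial_homM (graph_hom p) _ _ _. Qed.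

Lemma common_domain p q :
  exists s u v, [/\ denominator S s, graph p s u & graph q s v].
Proof.
have [s [u [Ss pu]]] := partial_hom_dom (graph_hom p).
have [t [v [St qv]]] := hom_dom_mul s (graph_hom q).
exists (t * s), (t * u), v; split=> //; first exact: denominatorM.
exact: graphM.
Qed.

Lemma common_domain3 p q r : exists s u v w,
  [/\ denominator S s, graph p s u, graph q s v & graph r s w].
Proof.
have [s [u [v [Ss pu qv]]]] := common_domain p q.
have [t [w [St rw]]] := hom_dom_mul s (graph_hom r).
exists (t * s), (t * u), (t * v), w; split; first exact: denominatorM.
- exact: graphM.
- exact: graphM.
- exact: rw.
Qed.

Fact fraction_addA : associative fraction_add.
Proof.
move=> p q r; have [s [u [v [w [Ss pu qv rw]]]]] := common_domain3 p q r.
apply: (fraction_eq Ss (graph_add pu (graph_add qv rw))).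
by rewrite addrA; exact: graph_add (graph_add pu qv) rw.
Qed.

Fact fraction_addC : commutative fraction_add.
Proof.
move=> p q; have [s [u [v [Ss pu qv]]]] := common_domain p q.
by apply: (fraction_eq Ss (graph_add pu qv)); rewrite addrC; apply: graph_add.
Qed.

Fact fraction_add0 : left_id (fraction_const 0) fraction_add.
Proof.
move=> p; have [s [u [Ss pu]]] := partial_hom_dom (graph_hom p).
apply: (fraction_eq Ss _ pu); rewrite -[u]add0r; apply: graph_add => //.
by apply: graph_const; rewrite mulr0.
Qed.

Fact fraction_addN : left_inverse (fraction_const 0) fraction_opp fraction_add.
Proof.
move=> p; have [s [u [Ss pu]]] := partial_hom_dom (graph_hom p).
apply: (fraction_eq Ss (graph_add (graph_opp pu) pu)).
by rewrite addNr; apply: graph_const; rewrite mulr0.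
Qed.

Fact fraction_mulA : associative fraction_mul.
Proof.
move=> p q r; have [s [u [Ss pu]]] := partial_hom_dom (graph_hom p).
have [t [v [St qv]]] := hom_dom_mul u (graph_hom q).
have [t' [w [St' rw]]] := hom_dom_mul v (graph_hom r).
have pu' := graphM t' (graphM t pu); have qv' := graphM t' qv.
have St's : denominator S (t' * (t * s)) by do 2!apply: denominatorM => //.
apply: (fraction_eq St's (graph_mul pu' (graph_mul qv' rw))).
exact: graph_mul (graph_mul pu' qv') rw.
Qed.

Fact fraction_mul1l : left_id (fraction_const 1) fraction_mul.
Proof.
move=> p; have [s [u [Ss pu]]] := partial_hom_dom (graph_hom p).
apply: (fraction_eq Ss _ pu); apply: graph_mul pu.
by apply: graph_const; rewrite mulr1.
Qed.

Fact fraction_mul1r : right_id (fraction_const 1) fraction_mul.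
Proof.
move=> p; have [s [u [Ss pu]]] := partial_hom_dom (graph_hom p).
apply: (fraction_eq Ss _ pu); apply: graph_mul (pu) _.
by apply: graph_const; rewrite mulr1.
Qed.

Fact fraction_mulDl : left_distributive fraction_mul fraction_add.
Proof.
move=> p q r; have [s [u [v [Ss pu qv]]]] := common_domain p q.
have [t [w [St rw]]] := hom_dom_mul u (graph_hom r).
have [t' [w' [St' rw']]] := hom_dom_mul (t * v) (graph_hom r).
have pu' := graphM t' (graphM t pu); have qv' := graphM t' (graphM t qv).
have rw2 := graphM t' rw.
have St's : denominator S (t' * (t * s)) by do 2!apply: denominatorM => //.
apply: (fraction_eq St's (graph_mul (graph_add pu' qv') _)).
  exact: partial_homD (graph_hom r) _ _ _ _ rw2 rw'.
by apply: graph_add; apply: graph_mul; eassumption.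
Qed.

Fact fraction_mulDr : right_distributive fraction_mul fraction_add.
Proof.
move=> p q r; have [s [u [Ss pu]]] := partial_hom_dom (graph_hom p).
have [t [v [St qv]]] := hom_dom_mul u (graph_hom q).
have [t' [w [St' rw]]] := hom_dom_mul (t * u) (graph_hom r).
have pu' := graphM t' (graphM t pu); have qv' := graphM t' qv.
have St's : denominator S (t' * (t * s)) by do 2!apply: denominatorM => //.
apply: (fraction_eq St's (graph_mul pu' (graph_add qv' rw))).
by apply: graph_add; apply: graph_mul; eassumption.
Qed.

HB.instance Definition _ := gen_eqMixin fraction.
HB.instance Definition _ := gen_choiceMixin fraction.
HB.instance Definition _ := GRing.isZmodule.Build fraction
  fraction_addA fraction_addC fraction_add0 fraction_addN.
HB.instance Definition _ := GRing.Zmodule_isPzRing.Build fraction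
  fraction_mulA fraction_mul1l fraction_mul1r fraction_mulDl fraction_mulDr.

Let one_dom := denominator1 S.

Fact fraction_const_zmod_morphism : zmod_morphism fraction_const.
Proof.
move=> a b; apply: (fraction_eq one_dom (graph_const (erefl _))).
rewrite mulrBr; apply: graph_add; first exact: graph_const.
by apply: graph_opp; apply: graph_const.
Qed.

Fact fraction_const_monoid_morphism : monoid_morphism fraction_const.
Proof.
split=> // a b; apply: (fraction_eq one_dom (graph_const (erefl _))).
by rewrite mulrA; apply: graph_mul; apply: graph_const.
Qed.

HB.instance Definition _ := GRing.isZmodMorphism.Build T fraction fraction_const
  fraction_const_zmod_morphism.
HB.instance Definition _ := GRing.isMonoidMorphism.Build T fraction fraction_const
  fraction_const_monoid_morphism.

Lemma fraction_const_inj a : fraction_const a = 0 -> a = 0.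
Proof.
move=> a0; have aa : graph (fraction_const a) 1 a by apply: graph_const; rewrite mul1r.
apply: (hom_inj (graph_hom (fraction_const a)) aa).
by rewrite a0; apply: graph_const; rewrite mulr0.
Qed.

Lemma fraction_const_invertible s :
  denominator S s -> invertible (fraction_const s).
Proof.
move=> Ss; exists (fraction_of (div_hom Ss)); split.
  have gs : graph (fraction_of (div_hom Ss)) s 1 by apply: fraction_ofE; rewrite mul1r.
  apply: (fraction_eq Ss (y := s) (graph_mul gs _)); apply: graph_const.
    by rewrite mul1r.
  by rewrite mulr1.
apply: (fraction_eq one_dom (y := 1)); last by apply: graph_const; rewrite mulr1.
by apply: (graph_mul (y := s)); [apply: graph_const | apply: fraction_ofE]; rewrite mul1r.
Qed.

Lemma fraction_numerator q :
  exists s a, denominator S s /\ fraction_const s * q = fraction_const a.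
Proof.
have [s [a [Ss qa]]] := partial_hom_dom (graph_hom q); exists s, a; split=> //.
apply: (fraction_eq one_dom (y := a)); last by apply: graph_const; rewrite mul1r.
by apply: graph_mul qa; apply: graph_const; rewrite mul1r.
Qed.

End Fractions.

(** * Semisimplicity of the ring of fractions and the equivalence *)

(** A left ideal I of fractions contracts to a left ideal of T that has a
complement J up to essential extension, so some denominator s is i + j with i in
I and j in J. Then e = s^-1 i works: for u in I, the element u - u e = u s^-1 j
lies in I and in the extension of J, which meet in zero. *)
Lemma goldie_fraction_split (T : pzRingType) (S : ore_set T) :
  (forall x : T, (forall r, x * r * x = 0) -> x = 0) -> left_goldie T ->
  (forall c, regular T c -> exists r, denominator S (r * c)) ->
  left_ideals_split (fraction S).
Proof.
move=> sp gT dense I Il; have [I0 ID IM] := Il.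
pose f := @fraction_const T S.
have fM : {morph f : x y / x * y} := rmorphM f.
have I'l : left_ideal (f @^-1` I) := left_ideal_contraction f Il.
have [J [Jl IJ0 IJess]] := essential_complement gT I'l.
have [c IJc creg] :=
  essential_left_regular sp gT (left_ideal_sum_set I'l Jl) IJess.
have [r Src] := dense c (left_regular_regular sp gT creg).
have [_ _ IJM] := left_ideal_sum_set I'l Jl.
have [i [j [Ii Jj rcE]]] := IJM r c IJc.
have [t [tf ft]] := fraction_const_invertible Src.
exists (t * f i); first exact: IM.
move=> u Iu; apply/eqP; rewrite -subr_eq0; apply/eqP.
have wE : u - u * (t * f i) = u * t * f j.
  apply/eqP; rewrite subr_eq addrC mulrA -mulrDr -rmorphD -rcE -mulrA.
  by rewrite tf mulr1.
have [s [a [Ss sw]]] := fraction_numerator (u * t).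
have [p [ps _]] := fraction_const_invertible Ss.
have aj0 : a * j = 0.
  apply: IJ0; split; last by case: Jl => _ _; apply.
  rewrite /preimage /mkset fM -[f a]sw -mulrA -wE.
  by apply: (IM); apply: left_idealB => //; rewrite mulrA; apply: IM.
have sw0 : f s * (u * t * f j) = 0 by rewrite mulrA sw -fM aj0 /f rmorph0.
by rewrite wE -[LHS]mul1r -ps -(mulrA p) -/f sw0 mulr0.
Qed.

Theorem theorem3p4 (R : pzRingType) :
  (exists (Q : pzRingType) (f : {rmorphism R -> Q}),
      is_left_localization (left_regular R) f /\ semisimple_artinian Q)
  <->
  (exists a : ideal R,
    [/\ (a : set R) = ass (left_regular R),
        semiprime_ideal a /\ finite_set (minimal_primes a),
        (forall p : ideal R, minimal_primes a p -> left_goldie (factor_ring p)) &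
        dense_in (factor_pi a @` left_regular R) (regular (factor_ring a))]).
Proof.
split=> [[Q [f [locf [art ss]]]]|[a [aE [asp afin] agoldie [Smul _ Ssub Sdense]]]].
  have split_Q := semisimple_split ss.
  have [[[[C1 CM C0] _] _] Cinv _ fker] := locf.
  have kerr x b : ass (left_regular R) x -> ass (left_regular R) (x * b).
    by move=> /fker fx0; apply/fker; rewrite rmorphM fx0 mul0r.
  have kerl : left_ideal (ass (left_regular R)).
    split=> [|x y /fker fx /fker fy|b x /fker fx]; apply/fker.
    - exact: rmorph0.
    - by rewrite rmorphD fx fy addr0.
    - by rewrite rmorphM fx mulr0.
  pose a := Ideal kerl kerr; exists a.
  have aP r : f r = 0 <-> ideal_set a r := fker r.
  have [Ms MsP] := minimal_prime_contracted locf split_Q aP.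
  have pi_f x y : factor_pi a x = factor_pi a y <-> f x = f y.
    split=> [/factor_pi_eq/aP|E].
      by rewrite rmorphB => /eqP; rewrite subr_eq0 => /eqP.
    by apply/factor_pi_eq/aP; rewrite rmorphB E subrr.
  split=> //.
  - split; first exact (semiprime_kernel locf split_Q aP).
    apply: (@sub_finite_set _ _ [set` map (contraction f) Ms]).
      by move=> P /MsP[M MMs ->] /=; apply: map_f.
    exact: finite_seq.
  - by move=> P /MsP[M _ ->]; exact: contraction_goldie locf split_Q M.
  - have N0 : ~ (factor_pi a @` left_regular R) 0.
      by move=> [c Cc /factor_pi_eq0[s Cs /Cc s0]]; apply: C0; rewrite -s0.
    split.
    + split=> [|_ _ [c Cc <-] [d Cd <-]|//]; first by exists 1; rewrite ?rmorph1.
      by exists (c * d); [exact: CM | exact: rmorphM].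
    + split=> [|s t [sl sr] [tl tr]|[T0 _]].
      * by split=> x; rewrite ?mulr1 ?mul1r.
      * by split=> x; rewrite ?mulrA -?mulrA; [rewrite mulrA => /tl/sl | move=> /sr/tr].
      * by apply: N0; exists 1; rewrite // rmorph1; apply: T0; rewrite mulr0.
    + move=> _ [c Cc <-]; have [p [pc cp]] := Cinv c Cc.
      split=> q; have [x <-] := factor_pi_surj q; rewrite -rmorphM => /factor_pi_eq0/aP.
        rewrite rmorphM => xc0; apply/factor_pi_eq0/aP.
        by rewrite -[LHS]mulr1 -cp mulrA xc0 mul0r.
      rewrite rmorphM => cx0; apply/factor_pi_eq0/aP.
      by rewrite -[LHS]mul1r -pc -mulrA cx0 mulr0.
    + move=> t; have [c <-] := factor_pi_surj t => -[creg _].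
      have [|r [s Cs rcs]] := regular_divides_denominator locf art aP (c := c).
        move=> x /factor_pi_eq0; rewrite rmorphM => /creg.
        exact: (factor_pi_eq0 a x).1.
      exists (factor_pi a r), s => //; rewrite -rmorphM.
      by apply/esym/pi_f.
pose T := factor_ring a; pose S : set T := factor_pi a @` left_regular R.
have gT : left_goldie T := semiprime_factor_goldie asp afin agoldie.
have spT (x : T) : (forall r, x * r * x = 0) -> x = 0.
  have [y <-] := factor_pi_surj x => yry; apply/factor_pi_eq0.
  apply: semiprime_ideal_elt => // r; apply/factor_pi_eq0.
  by rewrite !rmorphM; apply: yry.
have [S1 SM S0] := Smul.
have S_ore r s : S s -> exists s' r', S s' /\ s' * r = r' * s.
  move=> Ss; have [c [r' [creg E]]] := goldie_ore spT gT r (Ssub s Ss).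
  have [u Suc] := Sdense c creg.
  by exists (u * c), (u * r'); rewrite -!mulrA E.
pose D := OreSet S1 SM S_ore Ssub.
exists (fraction D), (@fraction_const T D \o factor_pi a)%FUN; split; last first.
  apply: split_semisimple_artinian; apply: goldie_fraction_split => //.
have assP x : ass (left_regular R) x <-> factor_pi a x = 0.
  by rewrite factor_pi_eq0 aE.
have left_regular_multiplicative : Defs.multiplicative (left_regular R).
  split=> [x|s t sl tl x|C0].
  - by rewrite mulr1.
  - by rewrite mulrA => /tl/sl.
  - by apply: S0; exists 0; rewrite // rmorph0.
split.
- split; last first.
    have [C1 _ _] := left_regular_multiplicative.
    by move=> r s Cs /Cs ->; exists 1; rewrite ?mulr0.
  split=> // r s Cs.
  have [_ [q [[s' Cs' <-]]]] := S_ore (factor_pi a r) (factor_pi a s) (imageP _ Cs).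
  have [r' <-] := factor_pi_surj q; rewrite -!rmorphM => /factor_pi_eq.
  rewrite -[ideal_set a _]/((a : set R) _) aE => -[t Ct].
  rewrite mulrBr => /eqP; rewrite subr_eq0 !mulrA => /eqP E.
  exists (t * s'), (t * r'); split=> //.
  by case: left_regular_multiplicative => _ H _; apply: H.
- by move=> s Cs; apply: (@fraction_const_invertible T D); exists s.
- move=> q; have [_ [x [[s Cs <-] E]]] := fraction_numerator q.
  by have [r rE] := factor_pi_surj x; exists s, r; rewrite /= E rE.
- move=> r; rewrite assP /=; split=> [|->]; first exact: fraction_const_inj.
  exact: rmorph0.
Qed.
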